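(* Let $(X,\mu,S,T)$ be an ergodic measure preserving system with commuting transformations $S,T$ such that $S^i\ne{\rm id}$ and $T^i\neq{\rm id}$ for all $i\neq0$. Let $f_0,f_1,f_2,f_3\in L^\infty(\mu)$. Then \[\frac{1}{N^4}\sum_{i,j,k,p=0}^{N-1} f_0(S^iT^jx)f_1(S^{i+k}T^jx)f_2(S^iT^{j+p}x)f_3(S^{i+k}T^{j+p}x)\] converges for $\mu$-a.e. $x$ as $N\to\infty$ to $\int f_0\otimes f_1\otimes f_2\otimes f_3\,d\mu_{S,T}$.
   Context: $\mathcal I_R$ is the $\sigma$-algebra of $R$-invariant sets. $\mu_S$ on $X^2$: $\int f_0\otimes f_1\,d\mu_S=\int\mathbb E(f_0|\mathcal I_S)\mathbb E(f_1|\mathcal I_S)d\mu$. $\mu_{S,T}$ on $X^4$: $\int f_0\otimes f_1\otimes f_2\otimes f_3\,d\mu_{S,T}=\int_{X^2}\mathbb E(f_0\otimes f_1|\mathcal I_{T\times T})\mathbb E(f_2\otimes f_3|\mathcal I_{T\times T})d\mu_S$. *)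

(* Defs.v *)
From HB Require Import structures.
From mathcomp Require Import all_boot all_order all_algebra.
From mathcomp Require Import all_classical all_reals all_analysis.
Set Implicit Arguments. Unset Strict Implicit. Unset Printing Implicit Defensive.
Import Order.TTheory GRing.Theory Num.Theory.
Import numFieldNormedType.Exports.
Local Open Scope classical_set_scope.
Local Open Scope ring_scope.

Section Defs.
Context {R : realType} {d : measure_display} {X : measurableType d}.

Definition measure_preserving (mu : {measure set X -> \bar R}) (S : X -> X) :=
  measurable_fun setT S /\ forall A, measurable A -> mu (S @^-1` A) = mu A.

Definition invertible_mfun (S : X -> X) :=
  exists S' : X -> X, measurable_fun setT S' /\ cancel S S' /\ cancel S' S.

Definition ergodic2 (mu : {measure set X -> \bar R}) (S T : X -> X) :=
  forall A, measurable A -> S @^-1` A = A -> T @^-1` A = A ->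
    mu A = 0%E \/ mu A = 1%E.

Definition Linfty (mu : {measure set X -> \bar R}) (f : X -> R) :=
  measurable_fun setT f /\ exists M : R, {ae mu, forall x, `|f x| <= M}.

Definition bounded_mfun (f : X -> R) :=
  measurable_fun setT f /\ exists M : R, forall x, `|f x| <= M.

End Defs.

Definition inv_sets {d} {Y : measurableType d} (Q : Y -> Y) : set (set Y) :=
  [set A | measurable A /\ Q @^-1` A = A].

Definition is_cond_exp {R : realType} {d} {Y : measurableType d}
  (nu : {measure set Y -> \bar R}) (G : set (set Y)) (f g : Y -> R) :=
  (forall B : set R, measurable B -> G (g @^-1` B)) /\
  nu.-integrable setT (EFin \o g) /\
  forall A, G A -> (\int[nu]_(y in A) (g y)%:E = \int[nu]_(y in A) (f y)%:E)%E.

Definition tens {X Y : Type} {R : realType} (f : X -> R) (g : Y -> R) :=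
  fun z : X * Y => f z.1 * g z.2.

Definition prodmap {Y : Type} (Q : Y -> Y) := fun z : Y * Y => (Q z.1, Q z.2).

Definition is_mu_S {R : realType} {d} {X : measurableType d}
  (mu : {measure set X -> \bar R}) (S : X -> X)
  (nu : {measure set (X * X)%type -> \bar R}) :=
  forall (f0 f1 e0 e1 : X -> R), bounded_mfun f0 -> bounded_mfun f1 ->
    is_cond_exp mu (inv_sets S) f0 e0 -> is_cond_exp mu (inv_sets S) f1 e1 ->
    (\int[nu]_z ((tens f0 f1) z)%:E = \int[mu]_x (e0 x * e1 x)%:E)%E.

Definition avg4 {R : realType} {X : Type} (S T : X -> X) (f0 f1 f2 f3 : X -> R)
  (N : nat) (x : X) : R :=
  (N%:R ^+ 4)^-1 *
  \sum_(i < N) \sum_(j < N) \sum_(k < N) \sum_(p < N)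
    (f0 (iter i S (iter j T x)) * f1 (iter (i + k) S (iter j T x)) *
     f2 (iter i S (iter (j + p) T x)) * f3 (iter (i + k) S (iter (j + p) T x))).

(* Main.v *)
(* Write mu_S for [nu], and P_Q f for the limit of the Birkhoff averages of f along Q.

   By Birkhoff's theorem in Maker's form (if h_N -> h boundedly a.e., then
   (1/N) sum_{i<N} h_N(Q^i z) -> P_Q h(z) a.e.), applied in turn to T x T, id x S
   and S x S on (X^2, mu_S), the averages in which f0, f2 are evaluated along the
   orbit of x and f1, f3 along that of y converge for mu_S-a.e. (x, y), and the
   integral of the limit is int P_{TxT}(f0 (x) f1) P_{TxT}(f2 (x) f3) dmu_S.

   It remains to replace y by x.  By Cauchy-Schwarz this follows once
     (1/N) sum_p |(1/N) sum_k [f1(S^k x) f3(S^k T^p x) - f1(S^k y) f3(S^k T^p y)]|^2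
   tends to 0 for mu_S-a.e. (x, y).  Expand the square: the mixed term converges by
   Maker's theorem, and the diagonal terms are bounded above, by convexity, by
   averages over windows of bounded length K.  The resulting upper bound is
   nonnegative and its integral tends to 0 as K grows, because two iterated limits of
   correlations agree; summing over all pairs of functions taken from {f1, f3} makes
   these correlations sums of squares, which allows the exchange.

   Hence the averages converge a.e.; their limit is invariant under S and T, so it is
   constant by ergodicity. *)
Require Import Defs.
From HB Require Import structures.
From mathcomp Require Import all_boot all_order all_algebra.
From mathcomp Require Import all_classical all_reals all_analysis.
From mathcomp Require Import measurable_realfun ring lra.
Import Order.TTheory GRing.Theory Num.Theory.
Import numFieldNormedType.Exports.
Local Open Scope classical_set_scope.
Local Open Scope ring_scope.

Set Implicit Arguments. Unset Strict Implicit. Unset Printing Implicit Defensive.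

(** * Sequences and Cesaro means *)

Section Sequences.
Context {R : realType}.
Implicit Types u v : nat -> R.

Lemma cvgP0 u (l : R) : u @ \oo --> l <->
  (forall e : R, 0 < e -> exists M : nat, forall n, (M <= n)%N -> `|u n - l| <= e).
Proof.
split=> [/cvgrPdist_le ul e e0|ul].
  have [M _ hM] := ul e e0; exists M => n Mn.
  by rewrite distrC; exact: hM.
apply/cvgrPdist_le => e e0; have [M hM] := ul e e0.
by exists M => // n /= Mn; rewrite distrC; exact: hM.
Qed.

Lemma bounded_seq u (B : R) : (forall n, `|u n| <= B) -> bounded_fun (u : nat -> R^o).
Proof.
move=> uB; exists B; split; first exact: num_real.
by move=> M BM n _; apply: le_trans (uB n) _; exact: ltW.
Qed.

Lemma limn_sup_ub u (B e : R) : (forall n, `|u n| <= B) -> 0 < e ->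
  exists M : nat, forall n, (M <= n)%N -> u n <= limn_sup u + e.
Proof.
move=> uB e0; have bu := bounded_seq uB; rewrite limn_supE//.
have hi : has_inf (range (sups (u : nat -> R^o))).
  split; first by exists (sups (u : nat -> R^o) 0%N); exists 0%N.
  exact: bounded_fun_has_lbound_sups.
have [_ [M _ <-] hM] := inf_adherent e0 hi.
exists M => n Mn; apply: le_trans (ltW hM).
apply: ub_le_sup; first exact/has_ubound_sdrop/bounded_fun_has_ubound.
by exists n.
Qed.

Lemma limn_sup_adherent u (B e : R) (N : nat) : (forall n, `|u n| <= B) -> 0 < e ->
  exists2 n : nat, (N <= n)%N & limn_sup u - e < u n.
Proof.
move=> uB e0; have bu := bounded_seq uB; rewrite limn_supE//.
have le_N : inf (range (sups (u : nat -> R^o))) <= sups (u : nat -> R^o) N.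
  by apply: ge_inf; [exact: bounded_fun_has_lbound_sups|exists N].
have hs : has_sup (sdrop (u : nat -> R^o) N).
  split; first by exists (u N); exists N => /=.
  exact/has_ubound_sdrop/bounded_fun_has_ubound.
have [_ [n /= Nn <-] hn] := sup_adherent e0 hs.
by exists n => //; apply: le_lt_trans hn; rewrite lerB.
Qed.

Lemma cvg_limn_sup u (l : R) : u @ \oo --> l -> limn_sup u = l.
Proof. by move=> /(@cvg_limn_inf_sup _ u) [_]. Qed.

Lemma limn_sup_norm u (B : R) : (forall n, `|u n| <= B) -> `|limn_sup u| <= B.
Proof.
move=> uB; rewrite ler_norml; apply/andP; split; apply/ler_addgt0Pr => e e0.
  have [M hM] := limn_sup_ub uB e0; apply: le_trans (hM M (leqnn _)).
  by have := uB M; rewrite ler_norml => /andP[].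
have [n _ hn] := limn_sup_adherent 0 uB e0.
rewrite -lerBlDr; apply: le_trans (ltW hn) _.
by have := uB n; rewrite ler_norml => /andP[].
Qed.

Lemma le_limn_sup_cvg u v (B C : R) : (forall n, `|u n| <= B) ->
  (forall n, `|v n| <= C) -> (fun n => u n - v n) @ \oo --> (0 : R) ->
  limn_sup u <= limn_sup v.
Proof.
move=> uB vC uv; apply/ler_addgt0Pr => e e0.
have e30 : 0 < e / 3 by rewrite divr_gt0.
have [M hM] := (cvgP0 _ _).1 uv _ e30.
have [M' hM'] := limn_sup_ub vC e30.
have [n Mn hn] := limn_sup_adherent (maxn M M') uB e30.
rewrite geq_max in Mn; case/andP: Mn => Mn M'n.
have := hM' n M'n; have := hM n Mn; rewrite subr0 ler_norml => /andP[_].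
by move: hn; lra.
Qed.

Lemma eq_limn_sup_cvg u v (B C : R) : (forall n, `|u n| <= B) ->
  (forall n, `|v n| <= C) -> (fun n => u n - v n) @ \oo --> (0 : R) ->
  limn_sup u = limn_sup v.
Proof.
move=> uB vC uv; apply/eqP; rewrite eq_le (le_limn_sup_cvg uB vC)//=.
apply: (le_limn_sup_cvg vC uB).
rewrite -oppr0 (_ : (fun n => _) = - (fun n => u n - v n)); first exact: cvgN.
by apply/funext => n; rewrite /= [in RHS]/GRing.opp /= opprB.
Qed.

(** The sum is limsup minus liminf of [u]. Below, a.e. convergence is obtained by showing that this
    oscillation has integral zero. *)
Lemma limn_supN_ge u (B : R) : (forall n, `|u n| <= B) ->
  0 <= limn_sup u + limn_sup (fun n => - u n).
Proof.
move=> uB; have uB' n : `|- u n| <= B by rewrite normrN.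
apply/ler_addgt0Pr => e e0; have e20 : 0 < e / 2 by rewrite divr_gt0.
have [M hM] := limn_sup_ub uB e20; have [M' hM'] := limn_sup_ub uB' e20.
have := hM (maxn M M') (leq_maxl _ _); have := hM' (maxn M M') (leq_maxr _ _).
lra.
Qed.

Lemma limn_supN_cvg u (B : R) : (forall n, `|u n| <= B) ->
  limn_sup u + limn_sup (fun n => - u n) = 0 -> u @ \oo --> limn_sup u.
Proof.
move=> uB uN; have uB' n : `|- u n| <= B by rewrite normrN.
apply/cvgP0 => e e0.
have [M hM] := limn_sup_ub uB e0; have [M' hM'] := limn_sup_ub uB' e0.
exists (maxn M M') => n; rewrite geq_max => /andP[Mn M'n].
have := hM n Mn; have := hM' n M'n; rewrite ler_norml.
by move=> h1 h2; apply/andP; split; lra.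
Qed.

(* Cesaro means; the convention [0^-1 = 0] makes [ces u 0] equal to [0]. *)
Definition ces u n : R := n%:R^-1 * \sum_(i < n) u i.

Lemma eq_ces u v n : (forall i, (i < n)%N -> u i = v i) -> ces u n = ces v n.
Proof. by move=> uv; congr (_ * _); apply: eq_bigr => i _; exact: uv. Qed.

Lemma le_ces u v n : (forall i, (i < n)%N -> u i <= v i) -> ces u n <= ces v n.
Proof.
move=> uv; apply: ler_wpM2l; first by rewrite invr_ge0.
by apply: ler_sum => i _; exact: uv.
Qed.

Lemma cesD u v n : ces (fun i => u i + v i) n = ces u n + ces v n.
Proof. by rewrite /ces big_split mulrDr. Qed.

Lemma cesZ c u n : ces (fun i => c * u i) n = c * ces u n.
Proof. by rewrite /ces -mulr_sumr mulrCA. Qed.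

Lemma cesZr c u n : ces (fun i => u i * c) n = ces u n * c.
Proof. by rewrite /ces -mulr_suml mulrA. Qed.

Lemma cesN u n : ces (fun i => - u i) n = - ces u n.
Proof. by rewrite /ces sumrN mulrN. Qed.

Lemma cesB u v n : ces (fun i => u i - v i) n = ces u n - ces v n.
Proof. by rewrite cesD cesN. Qed.

Lemma ces_sum (I : finType) (w : I -> nat -> R) n :
  ces (fun i => \sum_e w e i) n = \sum_e ces (w e) n.
Proof. by rewrite /ces exchange_big mulr_sumr. Qed.

Lemma ces_exchange (w : nat -> nat -> R) n m :
  ces (fun i => ces (w i) m) n = ces (fun j => ces (fun i => w i j) n) m.
Proof.
by rewrite /ces -!mulr_sumr exchange_big /= mulrCA.
Qed.

Lemma cesM u v n m : ces u n * ces v m = ces (fun i => ces (fun j => u i * v j) m) n.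
Proof. by under [RHS]eq_ces => i _ do rewrite cesZ; rewrite cesZr. Qed.

Lemma ces_cst_le c n : 0 <= c -> ces (fun=> c) n <= c.
Proof.
move=> c0; rewrite /ces sumr_const card_ord -(mulr_natr c) mulrCA.
case: n => [|n]; first by rewrite invr0 mul0r mulr0.
by rewrite mulVf ?mulr1// pnatr_eq0.
Qed.

Lemma ces_cst c n : (0 < n)%N -> ces (fun=> c) n = c.
Proof.
move=> n0; rewrite /ces sumr_const card_ord -(mulr_natr c) mulrCA mulVf ?mulr1//.
by rewrite pnatr_eq0 -lt0n.
Qed.

Lemma ler_norm_ces u n : `|ces u n| <= ces (fun i => `|u i|) n.
Proof.
rewrite /ces normrM ger0_norm ?invr_ge0//.
by apply: ler_wpM2l; [rewrite invr_ge0|exact: ler_norm_sum].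
Qed.

Lemma ces_ge0 u n : (forall i, 0 <= u i) -> 0 <= ces u n.
Proof. by move=> u0; rewrite mulr_ge0 ?invr_ge0 ?sumr_ge0. Qed.

Lemma ces_norm_le u n B : (forall i, `|u i| <= B) -> `|ces u n| <= B.
Proof.
move=> uB; apply: le_trans (ler_norm_ces _ _) _.
apply: le_trans (ces_cst_le n _); last by apply: le_trans (uB 0%N).
by apply: le_ces => i _.
Qed.

(** The variance of [u] over the first [n] indices is nonnegative. *)
Lemma ces_sqr_le u n : ces u n ^+ 2 <= ces (fun i => u i ^+ 2) n.
Proof.
case: n => [|n]; first by rewrite /ces !big_ord0 !mulr0 expr0n.
have : 0 <= ces (fun i => (u i - ces u n.+1) ^+ 2) n.+1.
  by apply: ces_ge0 => i; exact: sqr_ge0.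
under eq_ces => i _ do rewrite sqrrB -mulrnAl.
rewrite cesD cesB cesZr ces_cst//.
under [X in _ - X * _ + _]eq_ces => i _ do rewrite -mulr_natl.
rewrite cesZ; nra.
Qed.

Lemma ces_shift1 u n B : (forall i, `|u i| <= B) ->
  `|ces (fun i => u i.+1) n - ces u n| <= 2 * B / n%:R.
Proof.
move=> uB; rewrite -cesB /ces normrM ger0_norm ?invr_ge0// mulrC.
apply: ler_wpM2r; first by rewrite invr_ge0.
have -> : \sum_(i < n) (u i.+1 - u i) = u n - u 0%N.
  by rewrite -(big_mkord xpredT (fun i => u i.+1 - u i)) telescope_sumr.
by apply: le_trans (ler_normB _ _) _; rewrite mulr_natl mulr2n lerD.
Qed.

Lemma ces_shift u n B r : (forall i, `|u i| <= B) ->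
  `|ces (fun i => u (i + r)%N) n - ces u n| <= r%:R * (2 * B / n%:R).
Proof.
move=> uB; elim: r => [|r IHr].
  by under eq_ces => i _ do rewrite addn0; rewrite subrr normr0 mul0r.
under eq_ces => i _ do rewrite addnS.
have := @ces_shift1 (fun i => u (i + r)%N) n B (fun i => uB _).
move=> h; rewrite -natr1 mulrDl mul1r.
rewrite -(subrK (ces (fun i => u (i + r)%N) n) (ces _ n)) -addrA addrC.
by apply: le_trans (ler_normD _ _) _; rewrite lerD.
Qed.

Lemma cvg_divn (c : R) : (fun n => c / n%:R) @ \oo --> (0 : R).
Proof.
apply/cvgP0 => e e0; exists (Num.truncn (`|c| / e)).+1 => n Mn.
have n0 : 0 < n%:R :> R by rewrite ltr0n (leq_trans _ Mn).
rewrite subr0 normrM normfV (ger0_norm (ltW n0)) ler_pdivrMr// mulrC -ler_pdivrMr//.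
by apply: le_trans (ltW (truncnS_gt _)) _; rewrite ler_nat.
Qed.

Lemma ler_cvg2 u v (a b : R) : u @ \oo --> a -> v @ \oo --> b ->
  (forall n, u n <= v n) -> a <= b.
Proof.
move=> /cvgP0 ua /cvgP0 vb uv; apply/ler_addgt0Pr => e e0.
have e20 : 0 < e / 2 by rewrite divr_gt0.
have [M hM] := ua _ e20; have [M' hM'] := vb _ e20.
have := hM (maxn M M') (leq_maxl _ _); have := hM' (maxn M M') (leq_maxr _ _).
have := uv (maxn M M'); rewrite !ler_norml.
by move=> h /andP[h1 h2] /andP[h3 h4]; lra.
Qed.

Lemma cvg_sumR (I : Type) (r : seq I) (w : I -> nat -> R) (l : I -> R) :
  (forall i, w i @ \oo --> l i) ->
  (fun n => \sum_(i <- r) w i n) @ \oo --> \sum_(i <- r) l i.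
Proof.
move=> wl; elim: r => [|i r IHr].
  by under eq_fun do rewrite big_nil; rewrite big_nil; exact: cvg_cst.
by under eq_fun do rewrite big_cons; rewrite big_cons; exact: cvgD.
Qed.

Lemma cvg_ces (w : nat -> nat -> R) (l : nat -> R) K :
  (forall i, w i @ \oo --> l i) -> (fun n => ces (w ^~ n) K) @ \oo --> ces l K.
Proof. by move=> wl; apply: cvgMr; apply: cvg_sumR => i; exact: wl. Qed.

Lemma ces_sum2 (I : finType) (w : I -> I -> nat -> nat -> R) N K :
  ces (fun i => \sum_e \sum_e' ces (fun p => w e e' p i) N) K =
  \sum_e \sum_e' ces (fun p => ces (w e e' p) K) N.
Proof.
rewrite ces_sum; apply: eq_bigr => e _; rewrite ces_sum; apply: eq_bigr => e' _.
by rewrite ces_exchange.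
Qed.

(** A van der Corput estimate: averaging over windows of length [K] moves the mean by at most
    [K * (2 * D / N)], and convexity then takes the square inside the outer mean. *)
Lemma ces_window (u : nat -> R) D N K : (forall i, `|u i| <= D) -> (0 < K)%N ->
  ces u N ^+ 2 <= ces (fun k => ces (fun r => u (k + r)%N) K ^+ 2) N
    + (4 * D ^+ 2 * K%:R) / N%:R.
Proof.
move=> uD K0; have D0 : 0 <= D by apply: le_trans (uD 0%N).
set b := ces (fun k => ces (fun r => u (k + r)%N) K) N.
have bD : `|b| <= D by apply: ces_norm_le => k; exact: ces_norm_le.
have aD : `|ces u N| <= D by exact: ces_norm_le.
have ab : `|ces u N - b| <= K%:R * (2 * D / N%:R).
  rewrite /b ces_exchange -[X in X - _](ces_cst _ K0) -cesB.
  apply: le_trans (ler_norm_ces _ _) _.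
  have h : 0 <= K%:R * (2 * D / N%:R) by rewrite !mulr_ge0// invr_ge0.
  apply: le_trans (ces_cst_le K h); apply: le_ces => r rK; rewrite distrC.
  apply: le_trans (ces_shift N r uD) _; apply: ler_wpM2r; last first.
    by rewrite ler_nat ltnW.
  by rewrite !mulr_ge0// invr_ge0.
have := ces_sqr_le (fun k => ces (fun r => u (k + r)%N) K) N; rewrite -/b.
(* Difference of the two squares; the factor [ces u N + b] is at most [2 * D]. *)
have : (ces u N - b) * (ces u N + b) <= K%:R * (2 * D / N%:R) * (2 * D).
  apply: le_trans (ler_norm _) _; rewrite normrM ler_pM//.
  by apply: le_trans (ler_normD _ _) _; rewrite mulr_natl mulr2n lerD.
have -> : K%:R * (2 * D / N%:R) * (2 * D) = (4 * D ^+ 2 * K%:R) / N%:R by ring.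
move: (_ / _) => c; nra.
Qed.

End Sequences.

Lemma iter_prodmap (Y : Type) (Q : Y -> Y) n (z : Y * Y) :
  iter n (prodmap Q) z = (iter n Q z.1, iter n Q z.2).
Proof. by elim: n => [|n IHn]; [case: z|rewrite iterS IHn]. Qed.

Lemma iter_comm (Y : Type) (P Q : Y -> Y) i j (x : Y) :
  (forall x, P (Q x) = Q (P x)) -> iter i P (iter j Q x) = iter j Q (iter i P x).
Proof.
move=> PQ; elim: i => //= i ->; elim: j => //= j <-; exact: PQ.
Qed.

(** * Bounded measurable functions *)

Section BoundedFunctions.
Context {R : realType} {d : measure_display} {Y : measurableType d}.
Implicit Types f g : Y -> R.

Lemma bmf_cst (c : R) : bounded_mfun (fun _ : Y => c).
Proof. by split; [exact: measurable_cst|exists `|c|]. Qed.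

Lemma bmfD f g : bounded_mfun f -> bounded_mfun g ->
  bounded_mfun (fun x => f x + g x).
Proof.
move=> [mf [M fM]] [mg [N gN]]; split; first exact: measurable_funD.
by exists (M + N) => x; apply: le_trans (ler_normD _ _) _; rewrite lerD.
Qed.

Lemma bmfM f g : bounded_mfun f -> bounded_mfun g ->
  bounded_mfun (fun x => f x * g x).
Proof.
move=> [mf [M fM]] [mg [N gN]]; split; first exact: measurable_funM.
by exists (M * N) => x; rewrite normrM ler_pM.
Qed.

Lemma bmfN f : bounded_mfun f -> bounded_mfun (fun x => - f x).
Proof.
move=> [mf [M fM]]; split; first exact: measurableT_comp.
by exists M => x; rewrite normrN.
Qed.

Lemma bmfB f g : bounded_mfun f -> bounded_mfun g ->
  bounded_mfun (fun x => f x - g x).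
Proof. by move=> bf bg; apply: bmfD => //; exact: bmfN. Qed.

Lemma bmfX f n : bounded_mfun f -> bounded_mfun (fun x => f x ^+ n).
Proof.
move=> bf; elim: n => [|n IHn].
  by under [X in bounded_mfun X]eq_fun do rewrite expr0; exact: bmf_cst.
by under [X in bounded_mfun X]eq_fun do rewrite exprS; exact: bmfM.
Qed.

Lemma bmf_norm f : bounded_mfun f -> bounded_mfun (fun x => `|f x|).
Proof.
move=> [mf [M fM]]; split; first exact: measurableT_comp.
by exists M => x; rewrite normr_id.
Qed.

Lemma bmf_indic (A : set Y) : measurable A -> bounded_mfun (\1_A : Y -> R).
Proof.
move=> mA; split; first exact: measurable_indic.
by exists 1 => x; rewrite indicE; case: (_ \in _); rewrite ?normr1 ?normr0.
Qed.

Lemma bmf_sum (I : Type) (r : seq I) (f : I -> Y -> R) :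
  (forall i, bounded_mfun (f i)) -> bounded_mfun (fun x => \sum_(i <- r) f i x).
Proof.
move=> bf; elim: r => [|i r IHr].
  by under [X in bounded_mfun X]eq_fun do rewrite big_nil; exact: bmf_cst.
by under [X in bounded_mfun X]eq_fun do rewrite big_cons; exact: bmfD.
Qed.

Lemma bmf_ces n (f : nat -> Y -> R) :
  (forall i, bounded_mfun (f i)) -> bounded_mfun (fun x => ces (f ^~ x) n).
Proof.
by move=> bf; apply: bmfM; [exact: bmf_cst|apply: bmf_sum => i; exact: bf].
Qed.

Lemma bmf_limn_sup (f : nat -> Y -> R) (B : R) :
  (forall n, measurable_fun setT (f n)) -> (forall n x, `|f n x| <= B) ->
  bounded_mfun (fun x => limn_sup (f ^~ x)).
Proof.
move=> mf fB; split; last by exists B => x; exact: limn_sup_norm.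
apply: measurable_fun_limn_sup => // t _.
  by apply/bounded_fun_has_ubound/(@bounded_seq _ _ B) => n; exact: fB.
by apply/bounded_fun_has_lbound/(@bounded_seq _ _ B) => n; exact: fB.
Qed.

End BoundedFunctions.

Lemma bmf_comp {R : realType} d d' (X : measurableType d) (Y : measurableType d')
    (Q : X -> Y) (f : Y -> R) :
  measurable_fun setT Q -> bounded_mfun f -> bounded_mfun (fun x => f (Q x)).
Proof.
move=> mQ [mf [M fM]]; split; first exact: measurableT_comp mf mQ.
by exists M => x; exact: fM.
Qed.

Lemma measurable_iter d (Y : measurableType d) (Q : Y -> Y) n :
  measurable_fun setT Q -> measurable_fun setT (iter n Q).
Proof. 
move=> mQ; elim: n => [|n IHn]; first exact: measurable_id.
have -> : iter n.+1 Q = Q \o iter n Q by [].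
exact: measurableT_comp.
Qed.

(** * Integration against a probability measure *)

Section Integral.
Context {R : realType} {d : measure_display} {Y : measurableType d}.
Variable m : {measure set Y -> \bar R}.
Hypothesis m1 : m setT = 1%E.
Implicit Types f g : Y -> R.

Lemma bmf_integrable f : bounded_mfun f -> m.-integrable setT (EFin \o f).
Proof.
move=> [mf [M fM]]; apply: measurable_bounded_integrable => //.
  by rewrite m1 ltry.
exists M; split; first exact: num_real.
by move=> N MN x _; apply: le_trans (fM x) _; exact: ltW.
Qed.

Lemma Rint_cst (c : R) : \int[m]_x c = c.
Proof. by rewrite Rintegral_cst// m1 mulr1. Qed.

Lemma RintD f g : bounded_mfun f -> bounded_mfun g ->
  \int[m]_x (f x + g x) = \int[m]_x f x + \int[m]_x g x.
Proof. by move=> bf bg; rewrite RintegralD//; exact: bmf_integrable. Qed.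

Lemma RintB f g : bounded_mfun f -> bounded_mfun g ->
  \int[m]_x (f x - g x) = \int[m]_x f x - \int[m]_x g x.
Proof. by move=> bf bg; rewrite RintegralB//; exact: bmf_integrable. Qed.

Lemma RintZ c f : bounded_mfun f -> \int[m]_x (c * f x) = c * \int[m]_x f x.
Proof. by move=> bf; rewrite RintegralZl//; exact: bmf_integrable. Qed.

Lemma Rint_sum (I : Type) (r : seq I) (f : I -> Y -> R) :
  (forall i, bounded_mfun (f i)) ->
  \int[m]_x (\sum_(i <- r) f i x) = \sum_(i <- r) \int[m]_x f i x.
Proof.
move=> bf; elim: r => [|i r IHr].
  by rewrite big_nil; under eq_Rintegral do rewrite big_nil; rewrite Rint_cst.
rewrite big_cons; under eq_Rintegral do rewrite big_cons.
by rewrite RintD ?IHr//; exact: bmf_sum.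
Qed.

Lemma Rint_ces n (f : nat -> Y -> R) : (forall i, bounded_mfun (f i)) ->
  \int[m]_x ces (f ^~ x) n = ces (fun i => \int[m]_x f i x) n.
Proof.
by move=> bf; rewrite RintZ ?Rint_sum// => *; try apply: bmf_sum => *; exact: bf.
Qed.

Lemma le_Rint f g : bounded_mfun f -> bounded_mfun g ->
  (forall x, f x <= g x) -> \int[m]_x f x <= \int[m]_x g x.
Proof. by move=> bf bg fg; apply: le_Rintegral => //; exact: bmf_integrable. Qed.

Lemma Rint_ae f g : bounded_mfun f -> bounded_mfun g ->
  {ae m, forall x, f x = g x} -> \int[m]_x f x = \int[m]_x g x.
Proof.
move=> [mf _] [mg _] fg; congr fine; apply: ae_eq_integral => //.
- exact/measurable_EFinP.
- exact/measurable_EFinP.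
- by apply: filterS fg => x -> _.
Qed.

Lemma Rint_cvg (h : nat -> Y -> R) g (B : R) :
  (forall n, measurable_fun setT (h n)) -> (forall n x, `|h n x| <= B) ->
  bounded_mfun g -> {ae m, forall x, (h ^~ x) @ \oo --> g x} ->
  (fun n => \int[m]_x h n x) @ \oo --> \int[m]_x g x.
Proof.
move=> mh hB bg hg.
have [] := @dominated_convergence _ _ _ m setT measurableT
  (fun n => EFin \o h n) (EFin \o g) (EFin \o cst B).
- by move=> n; apply/measurable_EFinP.
- by apply/measurable_EFinP; case: bg.
- by apply: filterS hg => x hx _; apply: cvg_EFin => //; exact: nearW.
- by apply: bmf_integrable; exact: bmf_cst.
- by apply: aeW => x n _; rewrite /= lee_fin; exact: hB.
move=> _ _ hc; apply: fine_cvg.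
rewrite fineK//; apply: integrable_fin_num => //; exact: bmf_integrable.
Qed.

Lemma ae_eq0_Rint f : bounded_mfun f -> (forall x, 0 <= f x) ->
  \int[m]_x f x <= 0 -> {ae m, forall x, f x = 0}.
Proof.
move=> bf f0 if0.
have : (\int[m]_x `|(f x)%:E| = 0)%E.
  under eq_integral => x _ do rewrite /= ger0_norm//.
  apply/eqP; rewrite eq_le integral_ge0 ?andbT//; last first.
    by move=> x _; rewrite lee_fin.
  rewrite -(fineK (integrable_fin_num _ (bmf_integrable bf)))//.
move/ae_eq_integral_abs => /(_ measurableT).
move=> h; have : {ae m, forall x, setT x -> (f x)%:E = cst 0%E x}.
  by apply: h; apply/measurable_EFinP; case: bf.
by apply: filterS => x /(_ I) [].
Qed.

Lemma Rint_mp Q f : measure_preserving m Q -> bounded_mfun f ->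
  \int[m]_x f (Q x) = \int[m]_x f x.
Proof.
move=> [mQ mpQ] bf; congr fine.
transitivity (\int[pushforward m Q]_x (f x)%:E)%E.
  rewrite integral_pushforward ?preimage_setT//.
    by apply/measurable_EFinP; case: bf.
  by apply: (@bmf_integrable (fun x => f (Q x))); exact: bmf_comp.
apply: eq_measure_integral => A mA _; exact: mpQ.
Qed.

Lemma mp_iter Q n : measure_preserving m Q -> measure_preserving m (iter n Q).
Proof.
move=> [mQ mpQ]; split; first exact: measurable_iter.
elim: n => // n IHn A mA.
have -> : iter n.+1 Q @^-1` A = iter n Q @^-1` (Q @^-1` A) by [].
by rewrite IHn ?mpQ// -[X in measurable X]setTI; exact: mQ.
Qed.

Lemma mp_ae Q (P : Y -> Prop) : measure_preserving m Q ->
  {ae m, forall x, P x} -> {ae m, forall x, P (Q x)}.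
Proof.
move=> [mQ mpQ] [N [mN N0 PN]]; exists (Q @^-1` N); split.
- by rewrite -[X in measurable X]setTI; exact: mQ.
- by rewrite mpQ.
- by move=> x /= nP; exact: PN.
Qed.

(* Passing to [inf_k f k] avoids any monotonicity assumption on [f]. *)
Lemma ae_inf_small (f : nat -> Y -> R) :
  (forall k, bounded_mfun (f k)) -> {ae m, forall x, forall k, 0 <= f k x} ->
  (forall e : R, 0 < e -> exists k, \int[m]_x f k x <= e) ->
  {ae m, forall x, forall e : R, 0 < e -> exists k, f k x < e}.
Proof.
move=> bf f0 intf.
(* The infimum needs a lower bound at every point, while [f] is nonnegative only a.e.; the absolute
   values supply it and change [f] on a null set only. *)
pose F k x := `|f k x|; pose g x := infs (F ^~ x) 0%N.
have lbF x : has_lbound (range (F ^~ x)).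
  by exists 0 => _ [k _ <-]; exact: normr_ge0.
have lbF' x : has_lbound (sdrop (F ^~ x) 0).
  by exists 0 => _ [k _ <-]; exact: normr_ge0.
have bF k : bounded_mfun (F k) by apply: bmf_norm.
have gF k x : g x <= F k x by apply: ge_inf; [exact: lbF'|exists k].
have g0 x : 0 <= g x.
  by apply: lb_le_inf; [exists (F 0%N x), 0%N|move=> _ [k _ <-]; exact: normr_ge0].
have bg : bounded_mfun g.
  split; first by apply: measurable_fun_infs => // n; case: (bF n).
  have [_ [M FM]] := bF 0%N; exists M => x; rewrite ger0_norm//.
  by apply: le_trans (FM x); rewrite normr_id; exact: gF.
have : {ae m, forall x, g x = 0}.
  apply: ae_eq0_Rint => //; apply/ler_addgt0Pr => e /intf[k fke]; rewrite add0r.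
  apply: le_trans fke; rewrite (_ : \int[m]_x f k x = \int[m]_x F k x).
    exact: le_Rint.
  by apply: Rint_ae => //; apply: filterS f0 => x /(_ k) ?; rewrite /F ger0_norm.
move=> g0'; apply: filterS2 g0' f0 => x gx0 f0x e e0.
have [_ [k _ <-] hk] := inf_adherent e0 (conj (ex_intro _ (F 0%N x) (ex_intro2 _ _ 0%N (leqnn _) erefl)) (lbF' x)).
have {}hk : F k x < g x + e := hk.
by exists k; move: hk; rewrite gx0 add0r /F ger0_norm.
Qed.

End Integral.

(** * The theorems of Birkhoff and Maker *)

Section ErgodicAverages.
Context {R : realType} {Y : Type}.
Variable Q : Y -> Y.
Implicit Types f : Y -> R.

Definition av f n x := ces (fun i => f (iter i Q x)) n.

(* A pointwise [limsup], so that [lav f] is defined everywhere and strictly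
   [Q]-invariant; it is a version of the conditional expectation of [f]. *)
Definition lav f x := limn_sup (fun n => av f n x).

Lemma av_norm_le f B n x : (forall x, `|f x| <= B) -> `|av f n x| <= B.
Proof. by move=> fB; apply: ces_norm_le. Qed.

(** Shifting by [Q] changes a mean of length [n] by at most [2 * B / n]. The function may vary with
    [n], so that the statement also covers the fourfold averages, whose inner averages depend on
    [N]. *)
Lemma limn_sup_av_inv (w : nat -> Y -> R) B x : (forall n x, `|w n x| <= B) ->
  limn_sup (fun n => av (w n) n (Q x)) = limn_sup (fun n => av (w n) n x).
Proof.
move=> wB; apply: (@eq_limn_sup_cvg _ _ _ B B) => [n|n|]; try exact: av_norm_le.
apply/cvgP0 => e e0; have [M hM] := (cvgP0 _ _).1 (cvg_divn (2 * B)) e e0.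
exists M => n /hM; rewrite !subr0 => h; apply: le_trans (le_trans (ler_norm _) h).
apply: le_trans (@ces_shift1 _ (fun i => w n (iter i Q x)) n B _) => //.
by rewrite /av; under eq_ces => i _ do rewrite -iterSr.
Qed.

Lemma lav_inv f B x : (forall x, `|f x| <= B) -> lav f (Q x) = lav f x.
Proof. by move=> fB; apply: (limn_sup_av_inv (w := fun=> f)) => _; exact: fB. Qed.

Lemma lav_invariant f x : (forall x, f (Q x) = f x) -> lav f x = f x.
Proof.
(* The index starts at 1 because [ces u 0] is 0. *)
move=> fQ; apply: cvg_limn_sup; apply/cvgP0 => e e0; exists 1%N => n n1.
rewrite /av (@eq_ces _ _ (fun=> f x)); first by rewrite ces_cst// subrr normr0 ltW.
by move=> i _; elim: i => //= i <-; rewrite fQ.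
Qed.

Lemma lav_comm f (T : Y -> Y) x : (forall x, Q (T x) = T (Q x)) ->
  lav f (T x) = lav (fun x => f (T x)) x.
Proof.
move=> QT; congr limn_sup; apply/funext => n; apply: eq_ces => i _; congr f.
by elim: i => //= i ->; rewrite QT.
Qed.

End ErgodicAverages.

Section Birkhoff.
Context {R : realType} {d : measure_display} {Y : measurableType d}.
Variable m : {measure set Y -> \bar R}.
Hypothesis m1 : m setT = 1%E.
Variable Q : Y -> Y.
Hypothesis mpQ : measure_preserving m Q.
Implicit Types f g h : Y -> R.

Let mQ : measurable_fun setT Q. Proof. by case: mpQ. Qed.

Lemma bmf_iter f n : bounded_mfun f -> bounded_mfun (fun x => f (iter n Q x)).
Proof. by move=> bf; apply: bmf_comp bf; exact: measurable_iter. Qed.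

Lemma bmf_av f n : bounded_mfun f -> bounded_mfun (av Q f n).
Proof.
by move=> bf; apply: (@bmf_ces _ _ _ n (fun i x => f (iter i Q x))) => i; exact: bmf_iter.
Qed.

Lemma bmf_lav f : bounded_mfun f -> bounded_mfun (lav Q f).
Proof.
move=> bf; have [_ [B fB]] := bf; apply: (@bmf_limn_sup _ _ _ _ B) => n.
  by case: (bmf_av n bf).
by move=> x; exact: av_norm_le.
Qed.

Lemma Rint_av f n : bounded_mfun f -> (0 < n)%N ->
  \int[m]_x av Q f n x = \int[m]_x f x.
Proof.
move=> bf n0; rewrite (Rint_ces m1 n (f := fun i x => f (iter i Q x))).
  rewrite -[RHS](ces_cst _ n0); apply: eq_ces => i _.
  by rewrite (Rint_mp m1 (mp_iter i mpQ) bf).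
by move=> i; exact: bmf_iter.
Qed.

(** The maximum of the Birkhoff sums of [h] of lengths 0 to [n], in recursive form. *)
Let maxsum := fix M h n x :=
  if n is k.+1 then Num.max 0 (h x + M h k (Q x)) else 0.

(* Garsia's argument: [F = maxsum h n] satisfies [F - F \o Q <= h] where [0 < F]
   and [F - F \o Q <= 0] elsewhere. *)
Lemma maximal_ergodic h : bounded_mfun h ->
  (forall x, exists n : nat, 0 < \sum_(i < n) h (iter i Q x)) ->
  0 <= \int[m]_x h x.
Proof.
move=> bh hpos; pose F := maxsum h.
have FS n x : F n.+1 x = Num.max 0 (h x + F n (Q x)) by [].
have F0 n x : 0 <= F n x by case: n => // n; rewrite FS le_max lexx.
have bF n : bounded_mfun (F n).
  elim: n => [|n IHn]; first exact: bmf_cst.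
  have [mF [B FB]] : bounded_mfun (fun x => h x + F n (Q x)).
    by apply: bmfD => //; exact: bmf_comp.
  split; first by apply: measurable_maxr => //; exact: measurable_cst.
  exists B => x; apply: le_trans (FB x); rewrite FS.
  by rewrite ger0_norm ?le_max ?lexx// ge_max normr_ge0 ler_norm.
have Fmono n x : F n x <= F n.+1 x.
  elim: n x => [|n IHn] x; first exact: F0.
  by rewrite !FS ge_max !le_max lexx /= lerD2l IHn orbT.
have Fle n k x : (n <= k)%N -> F n x <= F k x.
  by move/subnK <-; elim: (k - n)%N => // j; move/le_trans; apply; exact: Fmono.
have sumF n x : \sum_(i < n) h (iter i Q x) <= F n x.
  elim: n x => [|n IHn] x; first by rewrite big_ord0.
  rewrite FS big_ord_recl le_max; apply/orP; right; rewrite lerD2l.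
  apply: le_trans (IHn _); apply: ler_sum => i _.
  by rewrite /= -iterSr.
(* The sets where [F n] is positive increase to the whole space by [hpos], so the integrals of [k n]
   tend to that of [h]. *)
pose k n x := h x * \1_[set x | 0 < F n x] x.
have bk n : bounded_mfun (k n).
  apply: bmfM => //; apply: bmf_indic; have [mF _] := bF n.
  by rewrite -[X in measurable X]setTI; apply: measurable_fun_ltr.
have kge n x : F n x - F n (Q x) <= k n x.
  rewrite /k indicE; have [F1|] := boolP (0 < F n x).
    rewrite mem_set// mulr1; move: F1; case: n => [|n]; first by rewrite ltxx.
    move=> F1; have := Fmono n (Q x); move: F1; rewrite FS lt_max ltxx /= => F1.
    by rewrite (max_idPr (ltW F1)); lra.
  rewrite -leNgt => F1; rewrite memNset/= ?mulr0; last by apply/negP; rewrite -leNgt.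
  by have := F0 n (Q x); lra.
have [B hB] := bh.2.
have kh : (fun n => \int[m]_x k n x) @ \oo --> \int[m]_x h x.
  apply: (Rint_cvg m1 (B := B)) => // [n|n x|].
  - by case: (bk n).
  - rewrite normrM indicE; apply: le_trans (hB x).
    by case: (_ \in _); rewrite ?normr1 ?normr0 ?mulr1 ?mulr0.
  - apply: aeW => x; apply/cvgP0 => e e0; have [N hN] := hpos x.
    exists N => n Nn; rewrite /k indicE mem_set /=.
      by rewrite mulr1 subrr normr0 ltW.
    exact: lt_le_trans hN (le_trans (sumF _ _) (Fle _ _ _ Nn)).
apply: (ler_cvg2 (cvg_cst 0) kh) => n.
apply: le_trans (le_Rint m1 _ (bk n) (kge n)).
  rewrite RintB//; last exact: bmf_comp.
  by rewrite Rint_mp// subrr.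
by apply: bmfB => //; exact: bmf_comp.
Qed.

(** The maximal inequality is applied to [f - lav Q f + e]. As [lav Q f] is invariant, the Birkhoff
    sum of length [n] is [n] times [av Q f n x - lav Q f x + e], which is positive for some [n] by
    definition of the limsup. *)
Lemma Rint_lav_le f : bounded_mfun f -> \int[m]_x lav Q f x <= \int[m]_x f x.
Proof.
move=> bf; have bP := bmf_lav bf; have [B fB] := bf.2.
apply/ler_addgt0Pr => e e0.
have : 0 <= \int[m]_x (f x - lav Q f x + e).
  apply: maximal_ergodic => [|x].
    by apply: bmfD; [exact: bmfB|exact: bmf_cst].
  have [n n1] := @limn_sup_adherent _ (fun n => av Q f n x) B e 1%N
                   (fun n => av_norm_le Q n x fB) e0.
  rewrite -/(lav Q f x) => hn; exists n.
  have n0 : 0 < n%:R :> R by rewrite ltr0n.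
  have -> : \sum_(i < n) (f (iter i Q x) - lav Q f (iter i Q x) + e)
      = n%:R * (av Q f n x - lav Q f x + e).
    rewrite /av /ces !mulrDr mulrA mulfV ?gt_eqF// mul1r big_split big_split /=.
    rewrite sumr_const card_ord !mulr_natl; congr (_ + _ + _).
    rewrite -[X in _ *+ X]card_ord -sumr_const; apply: eq_bigr => i _.
    by congr (- _); elim: (i : nat) => //= j <-; rewrite (lav_inv Q _ fB).
  by rewrite mulr_gt0//; lra.
rewrite RintD ?RintB ?Rint_cst//; last 2 first.
- exact: bmfB.
- exact: bmf_cst.
by move=> h; lra.
Qed.

(** The previous bound for [f] and for [- f] shows that the oscillation, which is nonnegative, has
    integral at most 0. *)
Lemma birkhoff_aux f : bounded_mfun f ->
  {ae m, forall x, av Q f ^~ x @ \oo --> lav Q f x} /\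
  \int[m]_x lav Q f x = \int[m]_x f x.
Proof.
move=> bf; have bf' := bmfN bf; have [B fB] := bf.2.
have i1 := Rint_lav_le bf; have i2 := Rint_lav_le bf'.
have bP := bmf_lav bf; have bP' := bmf_lav bf'.
have lavNE x : lav Q (fun x => - f x) x = limn_sup (fun n => - av Q f n x).
  by congr limn_sup; apply/funext => n; exact: cesN.
have iN : \int[m]_x (- f x) = - \int[m]_x f x.
  by under eq_Rintegral do rewrite -mulN1r; rewrite RintZ// mulN1r.
have p0 x : 0 <= lav Q f x + lav Q (fun x => - f x) x.
  by rewrite lavNE; apply: limn_supN_ge => n; exact: av_norm_le fB.
have := le_Rint m1 (bmf_cst 0) (bmfD bP bP') p0.
rewrite Rint_cst// RintD// => i3; split; last first.
  by apply/eqP; rewrite eq_le i1 /=; lra.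
have : {ae m, forall x, lav Q f x + lav Q (fun x => - f x) x = 0}.
  apply: (ae_eq0_Rint m1) => //; first exact: bmfD.
  by rewrite RintD//; lra.
apply: filterS => x; rewrite lavNE => h.
by apply: limn_supN_cvg h => n; exact: av_norm_le fB.
Qed.

Theorem birkhoff f : bounded_mfun f ->
  {ae m, forall x, av Q f ^~ x @ \oo --> lav Q f x}.
Proof. by move=> /birkhoff_aux[]. Qed.

Lemma Rint_lav f : bounded_mfun f -> \int[m]_x lav Q f x = \int[m]_x f x.
Proof. by move=> /birkhoff_aux[]. Qed.

Lemma lav_ge0 f : bounded_mfun f -> (forall x, 0 <= f x) ->
  {ae m, forall x, 0 <= lav Q f x}.
Proof.
move=> bf f0; apply: filterS (birkhoff bf) => x hx.
by apply: (ler_cvg2 (cvg_cst 0) hx) => n; exact: ces_ge0.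
Qed.

(** An invariant factor comes out of every average, so [lav Q f * g] is a.e. the limit of the
    averages of [f * g]. *)
Lemma Rint_lavM f g : bounded_mfun f -> bounded_mfun g ->
  (forall x, g (Q x) = g x) ->
  \int[m]_x (lav Q f x * g x) = \int[m]_x (f x * g x).
Proof.
move=> bf bg gQ; rewrite -(Rint_lav (bmfM bf bg)); apply: Rint_ae => //.
- by apply: bmfM => //; exact: bmf_lav.
- by apply: bmf_lav; exact: bmfM.
apply: filterS (birkhoff bf) => x hx; apply/esym/cvg_limn_sup.
rewrite (_ : (fun n => _) = (fun n => av Q f n x * g x)); first exact: cvgMl hx.
apply/funext => n; rewrite /av -cesZr; apply: eq_ces => i _; congr (_ * _).
by elim: i => //= i <-; rewrite gQ.
Qed.

(** [lav Q f] is the orthogonal projection of [av Q f n] on the invariant functions: in the integral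
    of [(av - lav) ^+ 2] the mixed term equals that of [lav ^+ 2]. *)
Lemma Rint_lav_sqr_le f n : bounded_mfun f -> (0 < n)%N ->
  \int[m]_x (lav Q f x ^+ 2) <= \int[m]_x (av Q f n x ^+ 2).
Proof.
move=> bf n0; have bP := bmf_lav bf; have bA := bmf_av n bf.
have [B fB] := bf.2; have PQ x := lav_inv Q x fB.
have PQi i x : lav Q f (iter i Q x) = lav Q f x by elim: i => //= i <-.
have := le_Rint m1 (bmf_cst 0) (bmfX 2 (bmfB bA bP)) (fun x => sqr_ge0 _).
rewrite Rint_cst//.
under eq_Rintegral do rewrite sqrrB -mulr_natl.
have bAP := bmfM bA bP.
rewrite RintD ?RintB ?RintZ//; try by
  [exact: bmfX|exact: bmfM (bmf_cst _) bAP|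
   exact: bmfB (bmfX 2 bA) (bmfM (bmf_cst _) bAP)].
suff -> : \int[m]_x (av Q f n x * lav Q f x) = \int[m]_x (lav Q f x ^+ 2) by lra.
under [RHS]eq_Rintegral do rewrite expr2.
rewrite Rint_lavM// -[RHS](Rint_av (bmfM bf bP) n0); apply: eq_Rintegral => x _.
by rewrite /av -cesZr; apply: eq_ces => i _; rewrite PQi.
Qed.

(** Strict invariance of [lav Q f] gives strictly invariant preimages, as [inv_sets] demands; the
    integrals over [A] agree by [Rint_lavM] with the indicator of [A]. *)
Lemma lav_cond_exp f : bounded_mfun f -> is_cond_exp m (inv_sets Q) f (lav Q f).
Proof.
move=> bf; have bP := bmf_lav bf; have [B fB] := bf.2.
have PQ x := lav_inv Q x fB.
split=> [D mD|]; [split|split].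
- by rewrite -[X in measurable X]setTI; apply: bP.1.
- by apply/seteqP; split=> x /=; rewrite PQ.
- exact: bmf_integrable.
move=> A [mA QA]; have bA := bmf_indic (R := R) mA.
have fin g : bounded_mfun g ->
    (\int[m]_(y in A) (g y)%:E = (\int[m]_y (g y * \1_A y))%:E)%E.
  move=> bg; rewrite fineK; last first.
    by apply: integrable_fin_num => //; apply: (bmf_integrable m1); exact: bmfM.
  rewrite integral_mkcond; apply: eq_integral => y _.
  by rewrite /patch indicE; case: (_ \in _); rewrite ?mulr1 ?mulr0.
rewrite !fin// Rint_lavM// => x; rewrite !indicE -{2}QA.
by congr (_%:R); congr nat_of_bool; apply/idP/idP; rewrite !inE.
Qed.

(** With [E M] the supremum of [|h n - g|] over [n >= M], the error at time [n >= M] is at most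
    [av Q (E M) n], which tends to [lav Q (E M)]. The integral of the latter is that of [E M] and
    tends to 0, so at almost every point some [M] makes it small. *)
Theorem maker (h : nat -> Y -> R) g (B : R) :
  (forall n, measurable_fun setT (h n)) -> (forall n x, `|h n x| <= B) ->
  bounded_mfun g -> {ae m, forall x, h ^~ x @ \oo --> g x} ->
  {ae m, forall x, (fun n => av Q (h n) n x) @ \oo --> lav Q g x}.
Proof.
move=> mh hB bg hg; have [C gC] := bg.2.
pose D n x := `|h n x - g x|.
have DB n x : `|D n x| <= B + C.
  by rewrite /D normr_id (le_trans (ler_normB _ _))// lerD.
have mD n : measurable_fun setT (D n).
  by apply: measurableT_comp => //; apply: measurable_funB => //; case: bg.
have ubD x : has_ubound (range (D ^~ x)).
  by exists (B + C) => _ [n _ <-]; apply: le_trans (DB n x); exact: ler_norm.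
pose E M x := sups (D ^~ x) M.
have DE M n x : (M <= n)%N -> D n x <= E M x.
  by move=> Mn; apply: ub_le_sup; [exact/has_ubound_sdrop|exists n].
have EB M x : `|E M x| <= B + C.
  rewrite ger0_norm; last by apply: le_trans (DE M M x (leqnn _)); exact: normr_ge0.
  apply: ge_sup; first by exists (D M x), M => /=.
  by move=> _ [n _ <-]; apply: le_trans (DB n x); exact: ler_norm.
have bE M : bounded_mfun (E M).
  by split; [exact: measurable_fun_sups|exists (B + C) => x; exact: EB].
have E0 M x : 0 <= E M x by apply: le_trans (DE M M x (leqnn _)); exact: normr_ge0.
have iE : (fun M => \int[m]_x E M x) @ \oo --> \int[m]_(x in setT) (0 : R).
  apply: (Rint_cvg m1 (B := B + C)) => // [n||]; [by case: (bE n)|exact: bmf_cst|].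
  apply: filterS hg => x hx; apply: cvg_sups.
  apply/cvgP0 => e e0; have [M hM] := (cvgP0 _ _).1 hx e e0; exists M => n Mn.
  by rewrite subr0 normr_id; exact: hM.
have small : {ae m, forall x, forall e : R, 0 < e -> exists M, lav Q (E M) x < e}.
  apply: (ae_inf_small m1) => [M||e e0]; first exact: bmf_lav.
    by apply: ae_foralln => M; exact: lav_ge0.
  have [M hM] := (cvgP0 _ _).1 iE e e0; exists M; rewrite Rint_lav//.
  have := hM M (leqnn _); rewrite Rint_cst// subr0.
  exact: le_trans (ler_norm _).
have bE' : {ae m, forall x, forall M, av Q (E M) ^~ x @ \oo --> lav Q (E M) x}.
  by apply: ae_foralln => M; exact: birkhoff.
near=> x; apply/cvgP0 => e e0.
have e30 : 0 < e / 3 by rewrite divr_gt0.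
have sx : forall e : R, 0 < e -> exists M, lav Q (E M) x < e by near: x.
have [M hM] := sx _ e30.
have bx : forall M, av Q (E M) ^~ x @ \oo --> lav Q (E M) x by near: x.
have [M1 hM1] := (cvgP0 _ _).1 (bx M) _ e30.
have gx : av Q g ^~ x @ \oo --> lav Q g x.
  by near: x; exact: birkhoff.
have [M2 hM2] := (cvgP0 _ _).1 gx _ e30.
exists (maxn M (maxn M1 M2)) => n; rewrite !geq_max => /and3P[Mn M1n M2n].
have := hM2 n M2n; have := hM1 n M1n; move: hM.
have : `|av Q (h n) n x - av Q g n x| <= av Q (E M) n x.
  rewrite /av -cesB; apply: le_trans (ler_norm_ces _ _) _.
  by apply: le_ces => i _; exact: DE.
rewrite !ler_norml => /andP[a1 a2] a3 /andP[a4 a5] /andP[a6 a7].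
by apply/andP; split; lra.
Unshelve. all: by end_near. Qed.

End Birkhoff.

(** * The joining mu_S *)

Lemma mp_comp {R : realType} d (Y : measurableType d) (m : {measure set Y -> \bar R})
    (P Q : Y -> Y) :
  measure_preserving m P -> measure_preserving m Q ->
  measure_preserving m (fun x => P (Q x)).
Proof.
move=> [mP mpP] [mQ mpQ]; split=> [|A mA]; first exact: measurableT_comp mP mQ.
rewrite -(mpP A mA) -(mpQ (P @^-1` A))//.
by rewrite -[X in measurable X]setTI; exact: mP.
Qed.

Section Joining.
Context {R : realType} {d : measure_display} {X : measurableType d}.
Variables (mu : {measure set X -> \bar R}) (mu1 : mu setT = 1%E).
Variables (S T : X -> X).
Hypotheses (S_mp : measure_preserving mu S) (T_mp : measure_preserving mu T).
Hypothesis ST : forall x, S (T x) = T (S x).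
Variable nu : {measure set (X * X)%type -> \bar R}.
Hypothesis hnu : is_mu_S mu S nu.
Implicit Types u v : X -> R.

Let bmf_lavS := bmf_lav S_mp.

Lemma Rint_joining u v : bounded_mfun u -> bounded_mfun v ->
  \int[nu]_z (u z.1 * v z.2) = \int[mu]_x (lav S u x * lav S v x).
Proof.
move=> bu bv; congr fine.
exact: hnu bu bv (lav_cond_exp mu1 S_mp bu) (lav_cond_exp mu1 S_mp bv).
Qed.

Lemma joining_rect (A B : set X) : measurable A -> measurable B ->
  nu (A `*` B) = (\int[mu]_x (lav S \1_A x * lav S \1_B x))%:E.
Proof.
move=> mA mB; have bA := bmf_indic (R := R) mA; have bB := bmf_indic (R := R) mB.
rewrite fineK; last first.
  apply: integrable_fin_num => //; apply: (bmf_integrable mu1).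
  by apply: bmfM; exact: bmf_lavS.
rewrite -(hnu bA bB (lav_cond_exp mu1 S_mp bA) (lav_cond_exp mu1 S_mp bB)).
rewrite -[X in nu X]setIT -integral_indic//; last exact: measurableX.
apply: eq_integral => z _; rewrite /tens !indicE -natrM mulnb; congr (_%:R%:E).
by congr nat_of_bool; apply/idP/andP; rewrite !inE.
Qed.

(** [nu] is given only through integrals of tensor products; its mass comes from the constant
    functions 1. *)
Lemma joining1 : nu setT = 1%E.
Proof.
rewrite -setXTT joining_rect//; apply: congr1.
rewrite -[RHS](Rint_cst mu1); apply: eq_Rintegral => x _.
by rewrite lav_invariant ?indicT ?mulr1// => y; rewrite indicT.
Qed.

(** Rectangles form an intersection-stable generator, and [nu] is finite. *)
Lemma joining_mp (Q : X * X -> X * X) : measurable_fun setT Q ->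
  (forall A B, measurable A -> measurable B ->
     nu (Q @^-1` (A `*` B)) = nu (A `*` B)) ->
  measure_preserving nu Q.
Proof.
move=> mQ QAB; split=> // C mC.
pose G := [set A `*` B | A in (measurable : set (set X)) & B in (measurable : set (set X))].
apply: (@measure_unique _ R _ G (fun=> setT) _ _ _ _ (pushforward nu Q) nu) => //.
- exact: measurable_prod_measurableType.
- move=> _ _ [A1 mA1 [B1 mB1 <-]] [A2 mA2 [B2 mB2 <-]].
  exists (A1 `&` A2); first exact: measurableI.
  by exists (B1 `&` B2); [exact: measurableI|rewrite setXI].
- by move=> _; exists setT => //; exists setT => //; rewrite setXTT.
- by rewrite bigcup_const.
- by move=> _ [A mA [B mB <-]]; exact: QAB.
- by move=> _; change (nu setT < +oo)%E; rewrite joining1 ltry.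
Qed.

(** Composition with [S] does not change the projection on [S]-invariant functions; this is why [S]
    may act on one coordinate alone and preserve [nu]. *)
Let lavS_indic_pre (A : set X) x : measurable A ->
  lav S (\1_(S @^-1` A) : X -> R) x = lav S \1_A x.
Proof.
move=> mA; have [_ [B AB]] := bmf_indic (R := R) mA.
by rewrite -(lav_inv S x AB) lav_comm.
Qed.

Let mpre (Q : X -> X) (A : set X) :
  measure_preserving mu Q -> measurable A -> measurable (Q @^-1` A).
Proof. by move=> [mQ _] mA; rewrite -[X in measurable X]setTI; exact: mQ. Qed.

Definition fstmap (z : X * X) := (S z.1, z.2).
Definition sndmap (z : X * X) := (z.1, S z.2).

Lemma fstmap_mp : measure_preserving nu fstmap.
Proof.
apply: joining_mp => [|A B mA mB].
  apply: measurable_fun_pair; last exact: measurable_snd.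
  by apply: measurableT_comp measurable_fst; case: S_mp.
have -> : fstmap @^-1` (A `*` B) = (S @^-1` A) `*` B by [].
rewrite (joining_rect (mpre S_mp mA) mB) (joining_rect mA mB).
apply: congr1.
apply: eq_Rintegral => x _.
rewrite (lavS_indic_pre x mA).
by [].
Qed.

Lemma sndmap_mp : measure_preserving nu sndmap.
Proof.
apply: joining_mp => [|A B mA mB].
  apply: measurable_fun_pair; first exact: measurable_fst.
  by apply: measurableT_comp measurable_snd; case: S_mp.
have -> : sndmap @^-1` (A `*` B) = A `*` (S @^-1` B) by [].
rewrite (joining_rect mA (mpre S_mp mB)) (joining_rect mA mB).
apply: congr1.
apply: eq_Rintegral => x _.
rewrite (lavS_indic_pre x mB).
by [].
Qed.

Lemma prodmapS_mp : measure_preserving nu (prodmap S).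
Proof. exact: (mp_comp fstmap_mp sndmap_mp). Qed.

(** Since [T] commutes with [S], projecting [\1_A \o T] gives the projection of [\1_A] composed with
    [T]; invariance of [mu] under [T] concludes. *)
Lemma prodmapT_mp : measure_preserving nu (prodmap T).
Proof.
apply: joining_mp => [|A B mA mB].
  by apply: measurable_fun_pair; apply: measurableT_comp => //; case: T_mp.
have -> : prodmap T @^-1` (A `*` B) = (T @^-1` A) `*` (T @^-1` B) by [].
have bA := bmf_indic (R := R) mA; have bB := bmf_indic (R := R) mB.
rewrite (joining_rect (mpre T_mp mA) (mpre T_mp mB)) (joining_rect mA mB).
apply: congr1; rewrite -(Rint_mp mu1 T_mp (bmfM (bmf_lavS bA) (bmf_lavS bB))).
by apply: eq_Rintegral => x _; rewrite (lav_comm \1_A x ST) (lav_comm \1_B x ST).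
Qed.

Let setXT (A : set X) : fst @^-1` A = A `*` (setT : set X).
Proof. by apply/predeqP => z; split=> [|[]]. Qed.

Let setTX (A : set X) : snd @^-1` A = (setT : set X) `*` A.
Proof. by apply/predeqP => z; split=> [|[]]. Qed.

(** The projection of the constant 1 is 1, so the marginals of [nu] are [mu]; through them a.e.
    statements pass from [mu] to [nu]. *)
Let joining_fst (A : set X) : measurable A -> nu (fst @^-1` A) = mu A.
Proof.
move=> mA; have bA := bmf_indic (R := R) mA.
rewrite setXT joining_rect//.
have -> : \int[mu]_x (lav S \1_A x * lav S \1_[set: X] x) = \int[mu]_x lav S \1_A x.
  apply: eq_Rintegral => x _; rewrite [X in _ * X]lav_invariant ?indicT ?mulr1//.
rewrite (Rint_lav mu1 S_mp bA) /Rintegral integral_indic// setIT fineK//.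
rewrite ge0_fin_numE//; apply: (@le_lt_trans _ _ (mu setT)); last by rewrite mu1 ltry.
by apply: le_measure; rewrite ?inE.
Qed.

Let joining_snd (A : set X) : measurable A -> nu (snd @^-1` A) = mu A.
Proof.
move=> mA; rewrite -joining_fst// setXT setTX.
rewrite (joining_rect measurableT mA) (joining_rect mA measurableT).
by apply: congr1; apply: eq_Rintegral => x _; rewrite mulrC.
Qed.

Lemma ae_fst (P : X -> Prop) :
  {ae mu, forall x, P x} -> {ae nu, forall z, P z.1}.
Proof.
move=> [N [mN N0 PN]]; exists (fst @^-1` N); split => //.
- by rewrite -[X in measurable X]setTI; exact: measurable_fst.
- by rewrite joining_fst.
- by move=> z /= nP; exact: PN.
Qed.

Lemma ae_snd (P : X -> Prop) :
  {ae mu, forall x, P x} -> {ae nu, forall z, P z.2}.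
Proof.
move=> [N [mN N0 PN]]; exists (snd @^-1` N); split => //.
- by rewrite -[X in measurable X]setTI; exact: measurable_snd.
- by rewrite joining_snd.
- by move=> z /= nP; exact: PN.
Qed.

Lemma Rint_fst u : bounded_mfun u -> \int[nu]_z u z.1 = \int[mu]_x u x.
Proof.
move=> bu; rewrite -(Rint_lav mu1 S_mp bu).
under eq_Rintegral do rewrite -(mulr1 (u _)).
rewrite (Rint_joining bu (bmf_cst 1)); apply: eq_Rintegral => x _.
by rewrite [X in _ * X]lav_invariant ?mulr1.
Qed.

Lemma Rint_snd u : bounded_mfun u -> \int[nu]_z u z.2 = \int[mu]_x u x.
Proof.
move=> bu; rewrite -(Rint_lav mu1 S_mp bu).
under eq_Rintegral do rewrite -(mul1r (u _)).
rewrite (Rint_joining (bmf_cst 1) bu); apply: eq_Rintegral => x _.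
by rewrite [X in X * _]lav_invariant ?mul1r.
Qed.

Lemma bmf_tens u v : bounded_mfun u -> bounded_mfun v -> bounded_mfun (tens u v).
Proof.
move=> bu bv; apply: bmfM; first exact: bmf_comp measurable_fst bu.
exact: bmf_comp measurable_snd bv.
Qed.

Definition diag_avg (F : X * X -> R) K x :=
  ces (fun r => ces (fun l => F (iter r S x, iter l S x)) K) K.

Lemma bmf_pair (Q1 Q2 : X -> X) (F : X * X -> R) : measurable_fun setT Q1 ->
  measurable_fun setT Q2 -> bounded_mfun F -> bounded_mfun (fun x => F (Q1 x, Q2 x)).
Proof. by move=> m1 m2 bF; apply: bmf_comp bF; exact: measurable_fun_pair. Qed.

Lemma bmf_diag_avg F K : bounded_mfun F -> bounded_mfun (diag_avg F K).
Proof.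
move=> bF; have [mS _] := S_mp.
apply: (@bmf_ces _ _ _ K (fun r x => ces (fun l => F (iter r S x, iter l S x)) K)) => r.
apply: (@bmf_ces _ _ _ K (fun l x => F (iter r S x, iter l S x))) => l.
by apply: bmf_pair => //; exact: measurable_iter.
Qed.

(** On [F], the diagonal measure averaged over the maps [S^r] x [S^l] with [r, l < K] tends to [nu].
    This holds for tensor products, hence for their finite combinations. *)
Definition diag_converges (F : X * X -> R) := bounded_mfun F /\
  (fun K => \int[mu]_x diag_avg F K x) @ \oo --> \int[nu]_z F z.

(** The double average factors into [av S u K x * av S v K x], so Birkhoff's theorem and bounded
    convergence apply. *)
Lemma diag_tens u v : bounded_mfun u -> bounded_mfun v -> diag_converges (tens u v).
Proof.
move=> bu bv; split; first exact: bmf_tens.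
rewrite (Rint_joining bu bv).
have E K x : diag_avg (tens u v) K x = av S u K x * av S v K x by rewrite /av cesM.
have [_ [B uB]] := bu; have [_ [C vC]] := bv.
apply: (Rint_cvg mu1 (B := B * C)) => [n|n x||].
- by case: (bmf_diag_avg n (bmf_tens bu bv)).
- by rewrite E normrM ler_pM// av_norm_le.
- by apply: bmfM; exact: bmf_lavS.
apply: filterS2 (birkhoff mu1 S_mp bu) (birkhoff mu1 S_mp bv) => x ux vx.
by under eq_fun do rewrite E; exact: cvgM.
Qed.

Lemma diag_sum (I : finType) (F : I -> X * X -> R) :
  (forall i, diag_converges (F i)) -> diag_converges (fun z => \sum_i F i z).
Proof.
move=> dF; have bF i := (dF i).1; split; first exact: bmf_sum.
rewrite (Rint_sum joining1)//.
rewrite (_ : (fun K => _) = (fun K => \sum_i \int[mu]_x diag_avg (F i) K x)).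
  by apply: cvg_sumR => i; exact: (dF i).2.
apply/funext => K; rewrite -(Rint_sum mu1) => [|i]; last exact: bmf_diag_avg.
apply: eq_Rintegral => x _; rewrite /diag_avg -ces_sum.
by apply: eq_ces => r _; rewrite -ces_sum.
Qed.

Lemma diag_scale c (F : X * X -> R) :
  diag_converges F -> diag_converges (fun z => c * F z).
Proof.
move=> [bF cF]; split; first exact: bmfM (bmf_cst c) bF.
rewrite (RintZ joining1)//.
rewrite (_ : (fun K => _) = (fun K => c * \int[mu]_x diag_avg F K x)).
  exact: cvgMr cF.
apply/funext => K; rewrite -(RintZ mu1); last exact: bmf_diag_avg.
apply: eq_Rintegral => x _; rewrite /diag_avg -cesZ.
by apply: eq_ces => r _; rewrite -cesZ.
Qed.

Lemma diag_ces (F : nat -> X * X -> R) n :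
  (forall i, diag_converges (F i)) -> diag_converges (fun z => ces (F ^~ z) n).
Proof. by move=> dF; apply: diag_scale; apply: diag_sum. Qed.

End Joining.

(** * Replacing y by x *)

Section KeyLemma.
Context {R : realType} {d : measure_display} {X : measurableType d}.
Variables (mu : {measure set X -> \bar R}) (mu1 : mu setT = 1%E).
Variables (S T : X -> X).
Hypotheses (S_mp : measure_preserving mu S) (T_mp : measure_preserving mu T).
Hypothesis ST : forall x, S (T x) = T (S x).
Variable nu : {measure set (X * X)%type -> \bar R}.
Hypothesis hnu : is_mu_S mu S nu.
Variable phi : bool -> X -> R.
Hypothesis bphi : forall e, bounded_mfun (phi e).

Let nu1 : nu setT = 1%E := joining1 mu1 S_mp hnu.
Let S1_mp := fstmap_mp mu1 S_mp hnu.
Let S2_mp := sndmap_mp mu1 S_mp hnu.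
Let TT_mp := prodmapT_mp mu1 S_mp T_mp ST hnu.
Let mS : measurable_fun setT S. Proof. by case: S_mp. Qed.

Definition pair_sum (z : X * X) := \sum_e phi e z.1 * phi e z.2.
Local Notation G := pair_sum.
Local Notation TT := (prodmap T).

Definition shift_prod e e' p x := phi e x * phi e' (iter p T x).

(** In the application [phi] lists [f1] and [f3], and the wanted term is the one pairing [f1] with
    [f3]. The other terms are nonnegative, and with them the whole is expressed through
    [pair_sum]. *)
Definition sq_diff N (z : X * X) :=
  \sum_e \sum_e' ces (fun p =>
    (av S (shift_prod e e' p) N z.1 - av S (shift_prod e e' p) N z.2) ^+ 2) N.

Let Gam N z := G z * av TT G N z.
Let GamL z := G z * lav TT G z.
(** The window length [K] is kept apart from the number [N] of shifts [p], so that [N] can tend to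
    infinity with [K] fixed. *)
Let alpha K N x y := ces (fun r => ces (fun l => Gam N (iter r S x, iter l S y)) K) K.

Let bG : bounded_mfun G.
Proof. by apply: bmf_sum => e; apply: (bmf_tens (bphi e) (bphi e)). Qed.

Let bGam N : bounded_mfun (Gam N).
Proof. by apply: bmfM => //; exact: (bmf_av TT_mp). Qed.

Let bGamL : bounded_mfun GamL.
Proof. by apply: bmfM => //; exact: (bmf_lav TT_mp). Qed.

(** Multiplying [G (a, b)] by [G] at the [p]-th iterate of [(a, b)] and regrouping by point turns
    each pair [e], [e'] into one function of [a] times the same function of [b]. *)
Let GamE N a b : Gam N (a, b) =
  \sum_e \sum_e' ces (fun p => shift_prod e e' p a * shift_prod e e' p b) N.
Proof.
rewrite /Gam {1}/pair_sum mulr_suml; apply: eq_bigr => e _.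
rewrite /av -cesZ -ces_sum; apply: eq_ces => p _; rewrite /pair_sum mulr_sumr.
by apply: eq_bigr => e' _; rewrite iter_prodmap /shift_prod /=; ring.
Qed.

Let alphaE K N x y : alpha K N x y =
  \sum_e \sum_e' ces (fun p =>
    av S (shift_prod e e' p) K x * av S (shift_prod e e' p) K y) N.
Proof.
rewrite /alpha; under eq_ces => r _.
  under eq_ces => l _ do rewrite GamE.
  rewrite (ces_sum2 (fun e e' p l => shift_prod e e' p (iter r S x) *
    shift_prod e e' p (iter l S y))); over.
rewrite ces_sum2; apply: eq_bigr => e _; apply: eq_bigr => e' _.
by apply: eq_ces => p _; rewrite /av cesM.
Qed.

Let sq_diffE N z : sq_diff N z =
  alpha N N z.1 z.1 - 2 * alpha N N z.1 z.2 + alpha N N z.2 z.2.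
Proof.
rewrite !alphaE mulr_sumr -sumrB -big_split; apply: eq_bigr => e _.
rewrite mulr_sumr -sumrB -big_split; apply: eq_bigr => e' _ /=.
by rewrite -cesZ -cesB -cesD; apply: eq_ces => p _; ring.
Qed.

Let crossL := lav (fstmap S) (lav (sndmap S) GamL).

(** Off the diagonal, [alpha n n] is an iterated average of [Gam n] along [sndmap] and then
    [fstmap]: Birkhoff for [prodmap T], then Maker twice. *)
Let cross_cvg : {ae nu, forall z,
  (fun n => alpha n n z.1 z.2) @ \oo --> crossL z}.
Proof.
have [_ [C GC]] := bG.
have GamC n z : `|Gam n z| <= C * C by rewrite normrM ler_pM// av_norm_le.
have h0 : {ae nu, forall z, Gam ^~ z @ \oo --> GamL z}.
  by apply: filterS (birkhoff nu1 TT_mp bG) => z hz; exact: cvgMr.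
have h1 := maker nu1 S2_mp (fun n => (bGam n).1) GamC bGamL h0.
have := maker nu1 S1_mp (fun n => (bmf_av S2_mp n (bGam n)).1)
  (fun n z => av_norm_le (sndmap S) n z (GamC n)) (bmf_lav S2_mp bGamL) h1.
apply: filterS => z; rewrite (_ : (fun n => alpha n n z.1 z.2) =
  (fun n => av (fstmap S) (av (sndmap S) (Gam n) n) n z))//; apply/funext => n.
apply: eq_ces => r _; apply: eq_ces => l _; congr Gam.
have -> : iter r (fstmap S) z = (iter r S z.1, z.2).
  by elim: (r) => [|i IHi]; [case: z|rewrite iterS IHi].
by elim: (l) => [|i IHi] //; rewrite [RHS]iterS -IHi.
Qed.

(** The integral of [crossL], and the level below which, up to any positive error, some integral of
    [diagL K] falls. *)
Let Lam := \int[nu]_z (lav TT G z ^+ 2).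

Let bcrossL : bounded_mfun crossL.
Proof. by apply: (bmf_lav S1_mp); exact: (bmf_lav S2_mp). Qed.

Let Rint_crossL : \int[nu]_z crossL z = Lam.
Proof.
rewrite /crossL (Rint_lav nu1 S1_mp); last exact: (bmf_lav S2_mp).
rewrite (Rint_lav nu1 S2_mp)//; have [_ [C GC]] := bG.
rewrite -(Rint_lavM nu1 TT_mp bG (bmf_lav TT_mp bG)).
  by apply: eq_Rintegral => z _; rewrite expr2.
by move=> z; exact: lav_inv GC.
Qed.

Let corr r l x := G (iter r S x, iter l S x).
(** The limit of [alpha K n x x] as [n] grows with [K] fixed. *)
Let diagL K x := ces (fun r => ces (fun l => corr r l x * lav T (corr r l) x) K) K.

Let bcorr r l : bounded_mfun (corr r l).
Proof. by apply: bmf_pair => //; exact: measurable_iter. Qed.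

Let bdiagL K : bounded_mfun (diagL K).
Proof.
apply: (@bmf_ces _ _ _ K (fun r x => ces (fun l => corr r l x * lav T (corr r l) x) K)) => r.
apply: (@bmf_ces _ _ _ K (fun l x => corr r l x * lav T (corr r l) x)) => l.
by apply: bmfM => //; exact: (bmf_lav T_mp).
Qed.

(** The diagonal may be [nu]-null, so a [nu]-a.e. statement says nothing there; commutation turns
    the average along [prodmap T] into one along [T] on [X], where Birkhoff's theorem for [mu]
    applies. *)
Let av_corr r l n x : av TT G n (iter r S x, iter l S x) = av T (corr r l) n x.
Proof.
by apply: eq_ces => p _; rewrite iter_prodmap /= /corr !(iter_comm _ _ _ ST).
Qed.

Let diag_cvg K : {ae mu, forall x,
  (fun n => av S (fun x => alpha K n x x) n x) @ \oo --> lav S (diagL K) x}.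
Proof.
have [_ [C GC]] := bG.
have GamC n z : `|Gam n z| <= C * C by rewrite normrM ler_pM// av_norm_le.
apply: (maker mu1 S_mp (B := C * C)) => // [n|n x|].
- by case: (bmf_diag_avg S_mp K (bGam n)).
- by apply: ces_norm_le => r; apply: ces_norm_le => l; exact: GamC.
have : {ae mu, forall x, forall r l, av T (corr r l) ^~ x @ \oo --> lav T (corr r l) x}.
  by apply: ae_foralln => r; apply: ae_foralln => l; exact: birkhoff.
apply: filterS => x hx; apply: cvg_ces => r; apply: cvg_ces => l.
rewrite (_ : (fun n => _) = (fun n => corr r l x * av T (corr r l) n x)).
  exact: cvgMr (hx r l).
by apply/funext => n; rewrite /Gam av_corr.
Qed.

(** On the diagonal each summand is a squared mean of length [N]; [ces_window] replaces it by
    squared means over windows of the fixed length [K]. *)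
Let alpha_le K : (0 < K)%N ->
  exists C : R, forall N x,
    alpha N N x x <= av S (fun x => alpha K N x x) N x + C / N%:R.
Proof.
move=> K0; have [Bt ht] := (bphi true).2; have [Bf hf] := (bphi false).2.
(* [D] bounds every [shift_prod]; the outer 4 counts the pairs [(e, e')] and the inner term is the
   error of [ces_window]. *)
pose D := (Bt + Bf) ^+ 2; exists (4 * (4 * D ^+ 2 * K%:R)) => N x.
have Bt0 : 0 <= Bt by apply: le_trans (ht x).
have Bf0 : 0 <= Bf by apply: le_trans (hf x).
have hphi e y : `|phi e y| <= Bt + Bf.
  by case: e; [apply: le_trans (ht y) _; rewrite lerDl|
               apply: le_trans (hf y) _; rewrite lerDr].
have hD e e' p y : `|shift_prod e e' p y| <= D.
  by rewrite normrM /D expr2 ler_pM.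
set c := 4 * D ^+ 2 * K%:R.
have c0 : 0 <= c / N%:R.
  by apply: mulr_ge0; rewrite ?invr_ge0//; do 2 apply: mulr_ge0 => //; exact: sqr_ge0.
have -> : av S (fun x => alpha K N x x) N x =
  \sum_e \sum_e' ces (fun p => ces (fun k =>
    ces (fun r => shift_prod e e' p (iter (k + r) S x)) K ^+ 2) N) N.
  rewrite /av; under eq_ces => k _ do rewrite alphaE.
  rewrite ces_sum2; apply: eq_bigr => e _; apply: eq_bigr => e' _.
  apply: eq_ces => p _; apply: eq_ces => k _; rewrite expr2 /av.
  by congr (_ * _); apply: eq_ces => r _; rewrite addnC iterD.
have -> : 4 * c / N%:R = \sum_(e : bool) \sum_(e' : bool) (c / N%:R).
  by rewrite !big_bool /= -mulrA; move: (c / _) => t; lra.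
rewrite alphaE -big_split; apply: ler_sum => e _.
rewrite -big_split; apply: ler_sum => e' _ /=.
apply: le_trans (lerD (lexx _) (ces_cst_le N c0)); rewrite -cesD.
by apply: le_ces => p _; rewrite -expr2; exact: ces_window.
Qed.

(* The limits in [K] and [M] can be exchanged because, both factors of [pair_sum]
   running over the same family [phi], the correlations form a sum of squares
   that decreases to its limit in [M]. *)
Let Rint_diagL_le K M : (0 < M)%N ->
  \int[mu]_x diagL K x <= \int[mu]_x diag_avg S (fun z => av TT G M z ^+ 2) K x.
Proof.
move=> M0; have bh := bmfX 2 (bmf_av TT_mp M bG).
have bg r l : bounded_mfun (fun x => corr r l x * lav T (corr r l) x).
  by apply: bmfM => //; exact: (bmf_lav T_mp).
have bh' r l : bounded_mfun (fun x => av TT G M (iter r S x, iter l S x) ^+ 2).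
  by apply: (bmf_pair _ _ bh); exact: measurable_iter.
rewrite (Rint_ces mu1 K (f := fun r x => ces (fun l => corr r l x * lav T (corr r l) x) K)); last first.
  by move=> r; exact: (@bmf_ces _ _ _ K (fun l x => corr r l x * lav T (corr r l) x)).
rewrite (Rint_ces mu1 K (f := fun r x =>
    ces (fun l => av TT G M (iter r S x, iter l S x) ^+ 2) K)); last first.
  by move=> r; exact: (@bmf_ces _ _ _ K (fun l x => av TT G M (iter r S x, iter l S x) ^+ 2)).
apply: le_ces => r _.
rewrite (Rint_ces mu1 K (f := fun l x => corr r l x * lav T (corr r l) x))//.
rewrite (Rint_ces mu1 K (f := fun l x => av TT G M (iter r S x, iter l S x) ^+ 2))//.
apply: le_ces => l _; under [leRHS]eq_Rintegral do rewrite av_corr.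
have [_ [C gC]] := bcorr r l.
(* The integrand becomes the square of [lav T (corr r l)], the projection of the average of length
   [M]. *)
rewrite -(Rint_lavM mu1 T_mp (bcorr r l) (bmf_lav T_mp (bcorr r l))).
  under eq_Rintegral do rewrite -expr2; exact: Rint_lav_sqr_le.
by move=> x; exact: lav_inv gC.
Qed.

(** For fixed [M] the square is a finite combination of tensor products of a function with
    itself. *)
Let diag_converges_av M : diag_converges mu S nu (fun z => av TT G M z ^+ 2).
Proof.
pose F e e' j k z := tens (fun x => phi e (iter j T x) * phi e' (iter k T x))
  (fun x => phi e (iter j T x) * phi e' (iter k T x)) z.
have -> : (fun z => av TT G M z ^+ 2) =
    (fun z => ces (fun j => ces (fun k => \sum_e \sum_e' F e e' j k z) M) M).
  apply/funext => z; rewrite expr2 /av cesM; apply: eq_ces => j _.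
  apply: eq_ces => k _; rewrite /pair_sum !iter_prodmap /= mulr_suml.
  apply: eq_bigr => e _; rewrite mulr_sumr; apply: eq_bigr => e' _.
  by rewrite /F /tens; ring.
apply: (diag_ces mu1 S_mp hnu) => j; apply: (diag_ces mu1 S_mp hnu) => k.
apply: (diag_sum mu1 S_mp hnu) => e; apply: (diag_sum mu1 S_mp hnu) => e'.
by apply: (diag_tens mu1 S_mp hnu); apply: bmfM; exact: (bmf_iter T_mp).
Qed.

(** [M] is fixed first, bringing the integral of the squared average near [Lam]; only then is [K]
    chosen, by diagonal convergence for that [M]. *)
Let Rint_diagL_small (e : R) : 0 < e -> exists K, \int[mu]_x diagL K.+1 x <= Lam + e.
Proof.
move=> e0; have e20 : 0 < e / 2 by rewrite divr_gt0.
have [_ [C GC]] := bG.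
have cM : (fun M => \int[nu]_z (av TT G M z ^+ 2)) @ \oo --> Lam.
  apply: (Rint_cvg nu1 (B := C ^+ 2)) => [n|n z||].
  - by case: (bmfX 2 (bmf_av TT_mp n bG)).
  - by rewrite normrX lerXn2r ?nnegrE// ?av_norm_le// (le_trans _ (GC z)).
  - by apply: bmfX; exact: (bmf_lav TT_mp).
  by apply: filterS (birkhoff nu1 TT_mp bG) => z hz; rewrite expr2; exact: cvgM.
have [M hM] := (cvgP0 _ _).1 cM _ e20.
have := hM M.+1 (leqnSn _).
have [_ cK] := diag_converges_av M.+1.
have [K hK] := (cvgP0 _ _).1 cK _ e20.
have := hK K.+1 (leqnSn _); have := Rint_diagL_le K.+1 (ltn0Sn M).
rewrite !ler_norml => h1 /andP[_ h2] /andP[_ h3]; exists K; lra.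
Qed.

(* [limsup sq_diff] is bounded by every [Psi K] below, so [Psi K] is nonnegative
   a.e., and its integral can be made arbitrarily small. *)
Theorem sq_diff_cvg0 : {ae nu, forall z, sq_diff ^~ z @ \oo --> (0 : R)}.
Proof.
(* Bound for the integral of [Psi K]: [I] stands for the integral of [diagL K.+1] and [L] for
   [Lam]. *)
have lin (a b c I L e : R) : a = I -> b = I -> c = L -> I <= L + e / 2 ->
  a + b - 2 * c <= e by move=> -> -> ->; lra.
pose Psi K z := lav S (diagL K.+1) z.1 + lav S (diagL K.+1) z.2 - 2 * crossL z.
have sq0 n z : 0 <= sq_diff n z.
  by do 2 apply: sumr_ge0 => ? _; apply: ces_ge0 => p; exact: sqr_ge0.
have bL K := bmf_lav S_mp (bdiagL K).
have bL1 K : bounded_mfun (fun z : X * X => lav S (diagL K) z.1).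
  exact: bmf_comp measurable_fst (bL K).
have bL2 K : bounded_mfun (fun z : X * X => lav S (diagL K) z.2).
  exact: bmf_comp measurable_snd (bL K).
have b2 : bounded_mfun (fun z => 2 * crossL z) by exact: bmfM (bmf_cst _) bcrossL.
have dcvg : {ae mu, forall x, forall K,
    (fun n => av S (fun x => alpha K.+1 n x x) n x) @ \oo --> lav S (diagL K.+1) x}.
  by apply: ae_foralln => K; exact: diag_cvg.
have bound : {ae nu, forall z, forall K, exists2 w : nat -> R,
    (forall n, sq_diff n z <= w n) & w @ \oo --> Psi K z}.
  have d1 := ae_fst mu1 S_mp hnu dcvg; have d2 := ae_snd mu1 S_mp hnu dcvg.
  apply: filterS3 d1 d2 cross_cvg => z h1 h2 h3 K; have [C hC] := alpha_le (ltn0Sn K).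
  exists (fun n => (av S (fun x => alpha K.+1 n x x) n z.1 + C / n%:R)
    + (av S (fun x => alpha K.+1 n x x) n z.2 + C / n%:R) - 2 * alpha n n z.1 z.2).
    by move=> n; rewrite sq_diffE; have := hC n z.1; have := hC n z.2; lra.
  rewrite /Psi -[X in X + _ - _]addr0 -[X in _ + X - _]addr0.
  apply: cvgB; last exact: cvgMr.
  by apply: cvgD; apply: cvgD; try exact: cvg_divn.
have small : {ae nu, forall z, forall e : R, 0 < e -> exists K, Psi K z < e}.
  apply: (ae_inf_small nu1) => [K||e e0].
  - by apply: bmfB => //; exact: bmfD.
  - apply: filterS bound => z hz K; have [w hw cw] := hz K.
    by apply: (ler_cvg2 (cvg_cst 0) cw) => n; exact: le_trans (hw n).
  have e20 : 0 < e / 2 by rewrite divr_gt0.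
  have [K hK] := Rint_diagL_small e20; exists K.
  have i1 : \int[nu]_z lav S (diagL K.+1) z.1 = \int[mu]_x diagL K.+1 x.
    by rewrite -(Rint_lav mu1 S_mp (bdiagL K.+1)); exact: (Rint_fst mu1 S_mp hnu (bL K.+1)).
  have i2 : \int[nu]_z lav S (diagL K.+1) z.2 = \int[mu]_x diagL K.+1 x.
    by rewrite -(Rint_lav mu1 S_mp (bdiagL K.+1)); exact: (Rint_snd mu1 S_mp hnu (bL K.+1)).
  rewrite (RintB nu1 (bmfD (bL1 K.+1) (bL2 K.+1)) b2).
  rewrite (RintD nu1 (bL1 K.+1) (bL2 K.+1)) (RintZ nu1 2 bcrossL).
  exact: (lin _ _ _ _ _ _ i1 i2 Rint_crossL hK).
apply: filterS2 bound small => z hz sz; apply/cvgP0 => e e0.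
have e20 : 0 < e / 2 by rewrite divr_gt0.
have [K hK] := sz _ e20; have [w hw cw] := hz K.
have [M hM] := (cvgP0 _ _).1 cw _ e20; exists M => n /hM.
rewrite ler_norml => /andP[_ hn]; rewrite subr0 ger0_norm//.
by apply: le_trans (hw n) _; lra.
Qed.

End KeyLemma.

(** * Convergence *)

Section Ergodicity.
Context {R : realType} {d : measure_display} {X : measurableType d}.
Variables (mu : probability X R) (S T : X -> X).

(** The sets where [F] is above or below its mean [c] are invariant. If one has measure 1, [F - c]
    has constant sign and integral 0; otherwise both are null. *)
Lemma ergodic2_const (F : X -> R) : ergodic2 mu S T -> bounded_mfun F ->
  (forall x, F (S x) = F x) -> (forall x, F (T x) = F x) ->
  {ae mu, forall x, F x = \int[mu]_x F x}.
Proof.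
move=> erg bF FS FT; set c := \int[mu]_x F x.
have mu1 : mu setT = 1%E := probability_setT mu.
have zero (G : X -> R) : bounded_mfun G -> \int[mu]_x G x = 0 ->
    {ae mu, forall x, 0 <= G x} -> {ae mu, forall x, G x = 0}.
  move=> bG iG G0; have bG' := bmf_norm bG.
  have : {ae mu, forall x, `|G x| = 0}.
    apply: (ae_eq0_Rint mu1 bG') => [x|]; first exact: normr_ge0.
    rewrite (Rint_ae bG' bG) ?iG//.
    by apply: filterS G0 => x /ger0_norm.
  by apply: filterS => x /eqP; rewrite normr_eq0 => /eqP.
have bFc := bmfB bF (bmf_cst c).
have bcF := bmfB (bmf_cst c) bF.
have iFc : \int[mu]_x (F x - c) = 0.
  by rewrite (RintB mu1 bF (bmf_cst c)) (Rint_cst mu1) subrr.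
have icF : \int[mu]_x (c - F x) = 0.
  by rewrite (RintB mu1 (bmf_cst c) bF) (Rint_cst mu1) subrr.
have full (A : set X) : measurable A -> mu A = 1%E -> {ae mu, forall x, A x}.
  move=> mA A1; exists (~` A); split => //; first exact: measurableC.
  by rewrite probability_setC// A1 subee.
have null (A : set X) : measurable A -> mu A = 0%E -> {ae mu, forall x, ~ A x}.
  by move=> mA A0; exists A; split => // x /=; rewrite not_notE.
have mF : measurable_fun setT F by case: bF.
have mA : measurable [set x | c < F x].
  by rewrite -[X in measurable X]setTI; exact: measurable_fun_ltr.
have mB : measurable [set x | F x < c].
  by rewrite -[X in measurable X]setTI; exact: measurable_fun_ltr.
have inv (Q : X -> X) (P : R -> Prop) : (forall x, F (Q x) = F x) ->
    Q @^-1` [set x | P (F x)] = [set x | P (F x)].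
  by move=> FQ; apply/seteqP; split=> x /=; rewrite FQ.
have [A0|A1] := erg _ mA (inv S (fun y => c < y) FS) (inv T (fun y => c < y) FT).
- have [B0|B1] := erg _ mB (inv S (fun y => y < c) FS) (inv T (fun y => y < c) FT).
  + apply: filterS2 (null _ mA A0) (null _ mB B0) => x /= /negP h1 /negP h2.
    by apply/eqP; rewrite eq_le !leNgt h1 h2.
  + have := zero _ bcF icF; have h := full _ mB B1.
    move=> /(_ _)/(filterS _); apply; last first.
      by apply: filterS h => x /= /ltW; rewrite subr_ge0.
    by move=> x /eqP; rewrite subr_eq0 => /eqP.
- have := zero _ bFc iFc; have h := full _ mA A1.
  move=> /(_ _)/(filterS _); apply; last first.
    by apply: filterS h => x /= /ltW; rewrite subr_ge0.
  by move=> x /eqP; rewrite subr_eq0 => /eqP.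
Qed.

End Ergodicity.

(** * Versions of the conditional expectation on invariant sets *)

Section ConditionalExpectation.
Context {R : realType} {d : measure_display} {Y : measurableType d}.
Variables (m : {measure set Y -> \bar R}) (Q : Y -> Y).
Implicit Types f g h : Y -> R.

Lemma cond_exp_measurable f g :
  is_cond_exp m (inv_sets Q) f g -> measurable_fun setT g.
Proof. by move=> [gB _] _ B mB; rewrite setTI; case: (gB B mB). Qed.

(** The level set of [g] through [x] is the preimage of a singleton, hence exactly invariant. *)
Lemma cond_exp_inv f g x : is_cond_exp m (inv_sets Q) f g -> g (Q x) = g x.
Proof.
move=> [gB _]; have [_ E] := gB [set g x] (measurable_set1 _).
have : (g @^-1` [set g x]) x by [].
by rewrite -E.
Qed.

(** The set where [g < h] is invariant, and [h - g] integrates to 0 over it. *)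
Let cond_exp_le f g h : is_cond_exp m (inv_sets Q) f g ->
  is_cond_exp m (inv_sets Q) f h -> {ae m, forall x, h x <= g x}.
Proof.
move=> cg ch; have mg := cond_exp_measurable cg; have mh := cond_exp_measurable ch.
pose P := [set x | g x < h x].
have mP : measurable P.
  by rewrite -[X in measurable X]setTI; exact: measurable_fun_ltr.
have PQ : inv_sets Q P.
  by split=> //; apply/seteqP; split=> x /=; rewrite /P /= (cond_exp_inv x cg) (cond_exp_inv x ch).
have [_ [ig Eg]] := cg; have [_ [ih Eh]] := ch.
have igP : m.-integrable P (EFin \o g) by apply: integrableS ig.
have ihP : m.-integrable P (EFin \o h) by apply: integrableS ih.
have : (\int[m]_(x in P) `|(h x - g x)%:E| = 0)%E.
  under eq_integral => x /set_mem Px.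
    rewrite /= ger0_norm ?subr_ge0 ?(ltW Px)// EFinB; over.
  rewrite integralB_EFin// (Eh P PQ) (Eg P PQ) -(Eg P PQ) subee//.
  exact: integrable_fin_num.
have mD : measurable_fun P (fun x => (h x - g x)%:E).
  by apply/measurable_EFinP; apply: measurable_funTS; exact: measurable_funB.
move=> /((ae_eq_integral_abs _ mP mD).1); apply: filterS => x hx; rewrite leNgt; apply/negP => Px.
by have [] := hx Px => /eqP; rewrite subr_eq0 => /eqP E; move: Px; rewrite /P /= E ltxx.
Qed.

Lemma cond_exp_unique f g h : is_cond_exp m (inv_sets Q) f g ->
  is_cond_exp m (inv_sets Q) f h -> {ae m, forall x, g x = h x}.
Proof.
move=> cg ch; apply: filterS2 (cond_exp_le cg ch) (cond_exp_le ch cg) => x h1 h2.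
by apply/eqP; rewrite eq_le h1 h2.
Qed.

Lemma cond_exp_ae f h g : measurable_fun setT f -> measurable_fun setT h ->
  {ae m, forall x, f x = h x} -> is_cond_exp m (inv_sets Q) f g ->
  is_cond_exp m (inv_sets Q) h g.
Proof.
move=> mf mh fh [gB [ig E]]; split => //; split => // A [mA QA].
rewrite E//; apply: ae_eq_integral => //.
- by apply: measurable_funTS; exact/measurable_EFinP.
- by apply: measurable_funTS; exact/measurable_EFinP.
- by apply: filterS fh => x -> _.
Qed.

End ConditionalExpectation.

Lemma Linfty_bounded {R : realType} d (X : measurableType d)
    (mu : {measure set X -> \bar R}) (f : X -> R) : Linfty mu f ->
  exists2 g : X -> R, bounded_mfun g & {ae mu, forall x, f x = g x}.
Proof.
(* Truncation at [|M|] rather than [M] keeps the two levels in order whatever the sign of [M]. *)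
move=> [mf [M fM]]; exists (fun x => Num.max (- `|M|) (Num.min (f x) `|M|)).
  split.
    by apply: measurable_maxr; [exact: measurable_cst|apply: measurable_minr].
  exists `|M| => x; rewrite ler_norml le_max lexx /= ge_max ge_min lexx orbT andbT.
  by apply: le_trans (normr_ge0 M); rewrite oppr_le0.
apply: filterS fM => x xM.
have : `|f x| <= `|M| by apply: le_trans xM (ler_norm _).
by rewrite ler_norml => /andP[h1 h2]; rewrite (min_idPl h2) (max_idPr h1).
Qed.

(** * The theorem for bounded functions *)

Section BoundedCase.
Context {R : realType} {d : measure_display} {X : measurableType d}.
Variables (mu : probability X R) (S T : X -> X).
Hypotheses (S_mp : measure_preserving mu S) (T_mp : measure_preserving mu T).
Hypothesis ST : forall x, S (T x) = T (S x).
Hypothesis erg : ergodic2 mu S T.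
Variable nu : {measure set (X * X)%type -> \bar R}.
Hypothesis hnu : is_mu_S mu S nu.
Variables f0 f1 f2 f3 : X -> R.
Hypotheses (b0 : bounded_mfun f0) (b1 : bounded_mfun f1)
           (b2 : bounded_mfun f2) (b3 : bounded_mfun f3).

Let mu1 : mu setT = 1%E := probability_setT mu.
Let nu1 : nu setT = 1%E := joining1 mu1 S_mp hnu.
Let S2_mp := sndmap_mp mu1 S_mp hnu.
Let SS_mp := prodmapS_mp mu1 S_mp hnu.
Let TT_mp := prodmapT_mp mu1 S_mp T_mp ST hnu.
Local Notation SS := (prodmap S).
Local Notation TT := (prodmap T).
Local Notation S2 := (sndmap S).

Let ST' : forall x, T (S x) = S (T x). Proof. by move=> x; rewrite ST. Qed.

Let avg N x := avg4 S T f0 f1 f2 f3 N x.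

Let U := tens f0 f1.
Let V := tens f2 f3.
Let bU : bounded_mfun U := bmf_tens b0 b1.
Let bV : bounded_mfun V := bmf_tens b2 b3.

Let psi p x := f1 x * f3 (iter p T x).

(** The averages over [k] and [p], with [f0], [f2] read at the first point and [f1], [f3] at the
    second; on the diagonal this is the inner half of the fourfold average. *)
Let core N (z : X * X) :=
  ces (fun p => f0 z.1 * f2 (iter p T z.1) * av S (psi p) N z.2) N.

Let avgE N x : avg N x = ces (fun i => ces (fun j => ces (fun k => ces (fun p =>
    f0 (iter i S (iter j T x)) * f1 (iter (i + k) S (iter j T x)) *
    f2 (iter i S (iter (j + p) T x)) * f3 (iter (i + k) S (iter (j + p) T x))) N) N) N) N.
Proof.
rewrite /avg /avg4 -exprVn !exprS expr0 mulr1 -!mulrA; congr (_ * _).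
rewrite 3!mulr_sumr; apply: eq_bigr => i _; congr (_ * _).
rewrite 2!mulr_sumr; apply: eq_bigr => j _; congr (_ * _).
rewrite mulr_sumr; apply: eq_bigr => k _; congr (_ * _).
Qed.

Let avg_core N x : avg N x =
  av S (fun x => av T (fun x => core N (x, x)) N x) N x.
Proof.
rewrite avgE; apply: eq_ces => i _; apply: eq_ces => j _.
rewrite /core ces_exchange; apply: eq_ces => p _ /=.
rewrite /av -cesZ; apply: eq_ces => k _; rewrite /psi -(iter_comm i j x ST).
set a := iter i S (iter j T x).
have e1 : iter (i + k) S (iter j T x) = iter k S a by rewrite addnC iterD.
have e2 : iter i S (iter (j + p) T x) = iter p T a.
  by rewrite addnC iterD (iter_comm i p _ ST).
have e3 : iter (i + k) S (iter (j + p) T x) = iter p T (iter k S a).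
  by rewrite (addnC i) iterD e2 (iter_comm k p _ ST).
rewrite e1 e2 e3; ring.
Qed.

(** The average over [k] moves only the second coordinate and commutes with [prodmap T], so it can
    be carried inside to [f1] and [f3]. *)
Let prodE N z : av (sndmap S) (av TT (fun z => U z * av TT V N z) N) N z =
  av TT (core N) N z.
Proof.
have S2E k (w : X * X) : iter k S2 w = (w.1, iter k S w.2).
  by elim: k => [|k IHk]; [case: w|rewrite iterS IHk].
rewrite /av ces_exchange; apply: eq_ces => j _.
under eq_ces => k _ do rewrite -cesZ.
rewrite ces_exchange /core; apply: eq_ces => p _.
rewrite /av -cesZ; apply: eq_ces => k _.
rewrite S2E !iter_prodmap /= /U /V /tens /psi /=.
rewrite (iter_comm k j _ ST); ring.
Qed.

Let gap N (z : X * X) := ces (fun p => `|av S (psi p) N z.1 - av S (psi p) N z.2|) N.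

Let bpsi p : bounded_mfun (psi p).
Proof. by apply: bmfM => //; exact: (bmf_iter T_mp). Qed.

Let bgap N : bounded_mfun (gap N).
Proof.
apply: (@bmf_ces _ _ _ N (fun p z => `|av S (psi p) N z.1 - av S (psi p) N z.2|)) => p.
have bA := bmf_av S_mp N (bpsi p).
apply: bmf_norm; apply: bmfB; first exact: bmf_comp measurable_fst bA.
exact: bmf_comp measurable_snd bA.
Qed.

Let core_gap : exists2 D : R, 0 <= D &
  forall N z, `|core N (z.1, z.1) - core N z| <= D * gap N z.
Proof.
have [_ [B0 h0]] := b0; have [_ [B2 h2]] := b2; exists (B0 * B2) => [|N z].
  (* A point of [X], which exists since [mu] has mass 1, shows that the bounds [B0] and [B2] are
     nonnegative. *)
  have [x|X0] := pselect (inhabited X); last first.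
    suff : False by [].
    apply: X0; apply/not_notP => X0.
    have : mu setT = 0%E.
      rewrite (_ : setT = set0) ?measure0//; apply/seteqP; split=> // x _.
      by apply: X0; constructor.
    by rewrite mu1 => /eqP; rewrite onee_eq0.
  by case: x => x; rewrite mulr_ge0// (le_trans (normr_ge0 _) (h0 x), le_trans (normr_ge0 _) (h2 x)).
rewrite /core /gap -cesB -cesZ; apply: le_trans (ler_norm_ces _ _) _.
apply: le_ces => p _; rewrite /= -mulrBr normrM; apply: ler_wpM2r => //.
by rewrite normrM ler_pM.
Qed.

(** By Cauchy-Schwarz the square of [gap] is at most the [(true, false)] term of [sq_diff] for the
    family [f1], [f3]. *)
Let gap_cvg0 : {ae nu, forall z, gap ^~ z @ \oo --> (0 : R)}.
Proof.
pose phi (e : bool) := if e then f1 else f3.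
have bphi e : bounded_mfun (phi e) by case: e.
apply: filterS (sq_diff_cvg0 mu1 S_mp T_mp ST hnu bphi) => z hz.
apply/cvgP0 => e e0; have e20 : 0 < e ^+ 2 by rewrite exprn_gt0.
have [M hM] := (cvgP0 _ _).1 hz _ e20; exists M => n /hM.
have g0 : 0 <= gap n z by apply: ces_ge0.
rewrite !subr0 (ger0_norm g0) => /(le_trans (ler_norm _)) h.
rewrite -(@ler_pXn2r _ 2) ?nnegrE ?(ltW e0)//; apply: le_trans h.
apply: le_trans (ces_sqr_le _ _) _.
under eq_ces => p _ do rewrite real_normK ?num_real//.
pose s b b' := ces (fun p => (av S (shift_prod T phi b b' p) n z.1 -
  av S (shift_prod T phi b b' p) n z.2) ^+ 2) n.
have s0 b b' : 0 <= s b b' by apply: ces_ge0 => p; exact: sqr_ge0.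
rewrite /sq_diff !big_bool; change (s true false <= s true true + s true false +
  (s false true + s false false)).
have := s0 true true; have := s0 false true; have := s0 false false.
move: (s true true) (s true false) (s false true) (s false false) => s1 s2 s3 s4.
lra.
Qed.

Let prodL := lav SS (lav S2 (lav TT (fun z => U z * lav TT V z))).

Let bUV : bounded_mfun (fun z => U z * lav TT V z).
Proof. by apply: bmfM => //; exact: (bmf_lav TT_mp). Qed.

Let bprodL : bounded_mfun prodL.
Proof.
by apply: (bmf_lav SS_mp); apply: (bmf_lav S2_mp); exact: (bmf_lav TT_mp).
Qed.

Let Rint_prodL : \int[nu]_z prodL z = \int[nu]_z (lav TT U z * lav TT V z).
Proof.
have bL1 := bmf_lav TT_mp bUV; have bL2 := bmf_lav S2_mp bL1.
rewrite (Rint_lav nu1 SS_mp bL2) (Rint_lav nu1 S2_mp bL1) (Rint_lav nu1 TT_mp bUV).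
have [_ [C VC]] := bV.
by rewrite (Rint_lavM nu1 TT_mp bU (bmf_lav TT_mp bV))// => z; exact: lav_inv VC.
Qed.

(** From the inside out: [p] by Birkhoff along [TT], then Maker for [j] along [TT], [k] along [S2]
    and [i] along [SS]. *)
Let prod_cvg : {ae nu, forall z,
  (fun n => av SS (fun z => av TT (core n) n z) n z) @ \oo --> prodL z}.
Proof.
have [_ [B hB]] := bU; have [_ [C hC]] := bV.
pose h n z := U z * av TT V n z.
have bh n : bounded_mfun (h n) by apply: bmfM => //; exact: (bmf_av TT_mp).
have hBC n z : `|h n z| <= B * C by rewrite normrM ler_pM// av_norm_le.
have c0 : {ae nu, forall z, h ^~ z @ \oo --> U z * lav TT V z}.
  by apply: filterS (birkhoff nu1 TT_mp bV) => z hz; exact: cvgMr.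
have c1 := maker nu1 TT_mp (fun n => (bh n).1) hBC bUV c0.
have bL1 := bmf_lav TT_mp bUV; have bL2 := bmf_lav S2_mp bL1.
have b1' n := bmf_av TT_mp n (bh n).
have h1 n z := av_norm_le TT n z (hBC n).
have c2 := maker nu1 S2_mp (fun n => (b1' n).1) h1 bL1 c1.
have b2' n := bmf_av S2_mp n (b1' n).
have h2 n z := av_norm_le S2 n z (h1 n).
have := maker nu1 SS_mp (fun n => (b2' n).1) h2 bL2 c2.
apply: filterS => z; rewrite (_ : (fun n => av SS (fun z => av TT (core n) n z) n z) =
  (fun n => av SS (av S2 (av TT (h n) n) n) n z))//.
by apply/funext => n; apply: eq_ces => i _; rewrite prodE.
Qed.

Let gap_avg_cvg0 : {ae nu, forall z,
  (fun n => av SS (fun z => av TT (gap n) n z) n z) @ \oo --> (0 : R)}.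
Proof.
have [_ [B1 h1]] := b1; have [_ [B3 h3]] := b3.
have gB n z : `|gap n z| <= B1 * B3 + B1 * B3.
  have psiB p x : `|psi p x| <= B1 * B3 by rewrite normrM ler_pM.
  apply: ces_norm_le => p; rewrite normr_id; apply: le_trans (ler_normB _ _) _.
  by apply: lerD; exact: av_norm_le.
have L0 (Q : X * X -> X * X) : lav Q (fun=> 0 : R) = (fun=> 0).
  by apply/funext => z; rewrite lav_invariant.
have c1 := maker nu1 TT_mp (fun n => (bgap n).1) gB (bmf_cst 0) gap_cvg0.
rewrite L0 in c1.
have bA n := bmf_av TT_mp n (bgap n).
have := maker nu1 SS_mp (fun n => (bA n).1)
  (fun n z => av_norm_le TT n z (gB n)) (bmf_cst 0) c1.
by rewrite L0.
Qed.

(** Reading [f1] and [f3] at [z.1] instead of [z.2] costs at most [D] times the average of [gap]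
    over [i] and [j], which tends to 0. *)
Let avg_fst_cvg : {ae nu, forall z, (fun n => avg n z.1) @ \oo --> prodL z}.
Proof.
have [D D0 hD] := core_gap.
apply: filterS2 prod_cvg gap_avg_cvg0 => z cz gz.
have dz : (fun n => avg n z.1 - av SS (fun z => av TT (core n) n z) n z) @ \oo --> (0 : R).
  apply/cvgP0 => e e0.
  have gz' : (fun n => D * av SS (fun z => av TT (gap n) n z) n z) @ \oo --> (0 : R).
    by rewrite -(mulr0 D); exact: cvgMr.
  have [M hM] := (cvgP0 _ _).1 gz' _ e0; exists M => n /hM.
  rewrite !subr0 => /(le_trans (ler_norm _)); apply: le_trans.
  have -> : avg n z.1 = av SS (fun z => av TT (fun z => core n (z.1, z.1)) n z) n z.
    rewrite avg_core; apply: eq_ces => i _; apply: eq_ces => j _.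
    by rewrite !iter_prodmap.
  rewrite /av -cesB; apply: le_trans (ler_norm_ces _ _) _; rewrite -cesZ.
  apply: le_ces => i _; rewrite -cesB; apply: le_trans (ler_norm_ces _ _) _.
  by rewrite -cesZ; apply: le_ces => j _; exact: hD.
rewrite -[prodL z]add0r (_ : (fun n => avg n z.1) = (fun n =>
  (avg n z.1 - av SS (fun z => av TT (core n) n z) n z) +
  av SS (fun z => av TT (core n) n z) n z)); first exact: cvgD.
by apply/funext => n; rewrite subrK.
Qed.

Let avg_norm_le : exists B : R, forall n x, `|avg n x| <= B.
Proof.
have [_ [B0 h0]] := b0; have [_ [B1 h1]] := b1.
have [_ [B2 h2]] := b2; have [_ [B3 h3]] := b3.
exists (B0 * B1 * B2 * B3) => n x; rewrite avgE.
by do 4 apply: ces_norm_le => ?; rewrite !normrM !ler_pM// ?mulr_ge0.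
Qed.

Let core_norm_le : exists B : R, forall n z, `|core n z| <= B.
Proof.
have [_ [B0 h0]] := b0; have [_ [B1 h1]] := b1.
have [_ [B2 h2]] := b2; have [_ [B3 h3]] := b3.
exists (B0 * B2 * (B1 * B3)) => n z; apply: ces_norm_le => p.
have psiB x : `|psi p x| <= B1 * B3 by rewrite normrM ler_pM.
rewrite normrM; apply: ler_pM => //; last exact: av_norm_le.
by rewrite normrM ler_pM.
Qed.

Let bavg n : bounded_mfun (avg n).
Proof.
have -> : avg n = (fun x => ces (fun i => ces (fun j => ces (fun k => ces (fun p =>
    f0 (iter i S (iter j T x)) * f1 (iter (i + k) S (iter j T x)) *
    f2 (iter i S (iter (j + p) T x)) * f3 (iter (i + k) S (iter (j + p) T x))) n) n) n) n).
  by apply/funext => x; exact: avgE.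
have bi f i j : bounded_mfun f -> bounded_mfun (fun x => f (iter i S (iter j T x))).
  move=> bf; have bS := bmf_comp (measurable_iter i S_mp.1) bf.
  exact: bmf_comp (measurable_iter j T_mp.1) bS.
apply: (@bmf_ces _ _ _ n (fun i x => ces (fun j => ces (fun k => ces (fun p => _) n) n) n)) => i.
apply: (@bmf_ces _ _ _ n (fun j x => ces (fun k => ces (fun p => _) n) n)) => j.
apply: (@bmf_ces _ _ _ n (fun k x => ces (fun p => _) n)) => k.
apply: (@bmf_ces _ _ _ n (fun p x => _)) => p.
by do 3 (apply: bmfM; last exact: bi); exact: bi.
Qed.

(** Convergence is known for [nu]-a.e. pair. It returns to [mu] through integrals: the oscillation
    [A + A'] depends on the first coordinate, whose law is [mu], and so has [mu]-integral 0. *)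
Theorem bounded_avg4_cvg : {ae mu, forall x,
  (fun N => avg4 S T f0 f1 f2 f3 N x) @ \oo -->
    \int[nu]_z (lav TT U z * lav TT V z)}.
Proof.
have [D hD] := core_norm_le; have [B hB] := avg_norm_le; pose A x := limn_sup (avg ^~ x).
have hB' n x : `|- avg n x| <= B by rewrite normrN.
pose A' x := limn_sup (fun n => - avg n x).
have bA : bounded_mfun A by apply: (bmf_limn_sup (B := B)) => // n; case: (bavg n).
have bA' : bounded_mfun A'.
  by apply: (bmf_limn_sup (B := B)) => // n; case: (bmfN (bavg n)).
have AA'0 x : 0 <= A x + A' x by apply: (limn_supN_ge (B := B)) => n; exact: hB.
have AS x : A (S x) = A x.
  pose w n x := av T (fun x => core n (x, x)) n x.
  have E y : A y = limn_sup (fun n => av S (w n) n y).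
    by congr limn_sup; apply/funext => n; exact: avg_core.
  have wD n y : `|w n y| <= D by exact: av_norm_le.
  by rewrite !E (limn_sup_av_inv S x wD).
have AT x : A (T x) = A x.
  pose w n x := av S (fun x => core n (x, x)) n x.
  have E y : A y = limn_sup (fun n => av T (w n) n y).
    (* The sums over [i] and [j] are exchanged to make the average along [T] the outer one. *)
    congr limn_sup; apply/funext => n; rewrite avg_core /av ces_exchange.
    apply: eq_ces => j _; apply: eq_ces => i _.
    by rewrite (iter_comm i j _ ST).
  have wD n y : `|w n y| <= D by exact: av_norm_le.
  by rewrite !E (limn_sup_av_inv T x wD).
have bA1 : bounded_mfun (fun z : X * X => A z.1) := bmf_comp measurable_fst bA.
have AL : {ae nu, forall z, A z.1 = prodL z}.
  by apply: filterS avg_fst_cvg => z; exact: cvg_limn_sup.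
have A'L : {ae nu, forall z, A' z.1 = - prodL z}.
  by apply: filterS avg_fst_cvg => z hz; apply: cvg_limn_sup; exact: cvgN.
have iA : \int[mu]_x A x = \int[nu]_z (lav TT U z * lav TT V z).
  by rewrite -Rint_prodL -(Rint_fst mu1 S_mp hnu bA); exact: Rint_ae.
have : {ae mu, forall x, A x + A' x = 0}.
  have bAA' := bmfD bA bA'; apply: (ae_eq0_Rint mu1 bAA' AA'0).
  rewrite -(Rint_fst mu1 S_mp hnu bAA') -(Rint_cst nu1 0) le_eqVlt.
  apply/orP; left; apply/eqP.
  apply: Rint_ae; [exact: bmf_comp measurable_fst bAA'|exact: bmf_cst|].
  by apply: filterS2 AL A'L => z -> ->; rewrite subrr.
apply: filterS2 (ergodic2_const erg bA AS AT) => x; rewrite iA => Ax A0.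
by rewrite -Ax; apply: (limn_supN_cvg (B := B)) => // n; exact: hB.
Qed.

End BoundedCase.

(** * From bounded functions to essentially bounded ones *)

Theorem theorem5p2 (R : realType) (d : measure_display) (X : measurableType d)
  (mu : probability X R) (S T : X -> X)
  (S_mp : measure_preserving mu S) (T_mp : measure_preserving mu T)
  (S_inv : invertible_mfun S) (T_inv : invertible_mfun T)
  (ST : forall x, S (T x) = T (S x))
  (erg : ergodic2 mu S T)
  (S_ne : forall i : nat, (0 < i)%N -> iter i S <> id)
  (T_ne : forall i : nat, (0 < i)%N -> iter i T <> id)
  (f0 f1 f2 f3 : X -> R)
  (hf0 : Linfty mu f0) (hf1 : Linfty mu f1)
  (hf2 : Linfty mu f2) (hf3 : Linfty mu f3)
  (nu : {measure set (X * X)%type -> \bar R}) (hnu : is_mu_S mu S nu)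
  (g h : X * X -> R)
  (hg : is_cond_exp nu (inv_sets (prodmap T)) (tens f0 f1) g)
  (hh : is_cond_exp nu (inv_sets (prodmap T)) (tens f2 f3) h) :
  {ae mu, forall x,
    (fun N => (avg4 S T f0 f1 f2 f3 N x)%:E) @ \oo -->
      (\int[nu]_z (g z * h z)%:E)%E}.
Proof.
have mu1 : mu setT = 1%E := probability_setT mu.
have nu1 := joining1 mu1 S_mp hnu.
have TT_mp := prodmapT_mp mu1 S_mp T_mp ST hnu.
have [f0' b0 e0] := Linfty_bounded hf0; have [f1' b1 e1] := Linfty_bounded hf1.
have [f2' b2 e2] := Linfty_bounded hf2; have [f3' b3 e3] := Linfty_bounded hf3.
have tens_ae (u v u' v' : X -> R) : {ae mu, forall x, u x = u' x} ->
    {ae mu, forall x, v x = v' x} -> {ae nu, forall z, tens u v z = tens u' v' z}.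
  move=> uu vv; apply: filterS2 (ae_fst mu1 S_mp hnu uu) (ae_snd mu1 S_mp hnu vv).
  by move=> z; rewrite /tens => -> ->.
have mtens (u v : X -> R) : measurable_fun setT u -> measurable_fun setT v ->
    measurable_fun setT (tens u v).
  move=> mu' mv; apply: measurable_funM; first exact: measurableT_comp mu' measurable_fst.
  exact: measurableT_comp mv measurable_snd.
(* [g] is an arbitrary version; both tensor products agree [nu]-a.e., so uniqueness identifies [g]
   with the pointwise limsup. *)
have gE : {ae nu, forall z, g z = lav (prodmap T) (tens f0' f1') z}.
  apply: (cond_exp_unique _ (lav_cond_exp nu1 TT_mp (bmf_tens b0 b1))).
  apply: (cond_exp_ae _ _ (tens_ae _ _ _ _ e0 e1) hg).
    by apply: mtens; [case: hf0|case: hf1].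
  by apply: mtens; [case: b0|case: b1].
have hE : {ae nu, forall z, h z = lav (prodmap T) (tens f2' f3') z}.
  apply: (cond_exp_unique _ (lav_cond_exp nu1 TT_mp (bmf_tens b2 b3))).
  apply: (cond_exp_ae _ _ (tens_ae _ _ _ _ e2 e3) hh).
    by apply: mtens; [case: hf2|case: hf3].
  by apply: mtens; [case: b2|case: b3].
have bL1 := bmf_lav TT_mp (bmf_tens b0 b1).
have bL2 := bmf_lav TT_mp (bmf_tens b2 b3).
have -> : (\int[nu]_z (g z * h z)%:E = (\int[nu]_z (lav (prodmap T) (tens f0' f1') z *
    lav (prodmap T) (tens f2' f3') z))%:E)%E.
  rewrite fineK; last first.
    by apply: integrable_fin_num => //; apply: (bmf_integrable nu1); exact: bmfM.
  apply: ae_eq_integral => //.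
  - apply/measurable_EFinP; apply: measurable_funM.
      exact: cond_exp_measurable hg.
    exact: cond_exp_measurable hh.
  - by apply/measurable_EFinP; have [] := bmfM bL1 bL2.
  - by apply: filterS2 gE hE => z -> -> _.
(* A null set has null preimages under the countably many maps [S^i T^j], so the bounded
   representatives may replace the functions along whole orbits. *)
have orbit_ae (u u' : X -> R) : {ae mu, forall x, u x = u' x} ->
    {ae mu, forall x, forall i j, u (iter i S (iter j T x)) = u' (iter i S (iter j T x))}.
  move=> uu; apply: ae_foralln => i; apply: ae_foralln => j.
  have := mp_ae (mp_iter j T_mp) (mp_ae (mp_iter i S_mp) uu); exact.
have avgE : {ae mu, forall x, forall N,
    avg4 S T f0 f1 f2 f3 N x = avg4 S T f0' f1' f2' f3' N x}.
  have a0 := orbit_ae _ _ e0; have a1 := orbit_ae _ _ e1.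
  have a2 := orbit_ae _ _ e2; have a3 := orbit_ae _ _ e3.
  near=> x => N; congr (_ * _).
  apply: eq_bigr => i _; apply: eq_bigr => j _; apply: eq_bigr => k _.
  by apply: eq_bigr => p _; rewrite (near a0 x)// (near a1 x)// (near a2 x)// (near a3 x).
apply: filterS2 avgE (bounded_avg4_cvg S_mp T_mp ST erg hnu b0 b1 b2 b3) => x Ex cx.
by under eq_fun do rewrite Ex; apply: cvg_EFin => //; exact: nearW.
Unshelve. all: by end_near. Qed.
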